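(* Let $n\ge0$ be an integer and let $\Lambda\subseteq\mathbb{C}$ be a lattice with $s(\Lambda)>n+1$. Then $\Lambda$ is an interpolating sequence for $\mathcal{F}^{n+1}_2(\mathbb{C})$, i.e. for every $(a_\lambda)_{\lambda\in\Lambda}\in\ell^{2}(\Lambda)$ there exists $F\in\mathcal{F}^{n+1}_2(\mathbb{C})$ with $F(\lambda)e^{-\pi|\lambda|^{2}/2}=a_\lambda$ for all $\lambda\in\Lambda$. Moreover, this interpolation problem is solved by $$F(z)=\sum_{\lambda\in\Lambda}a_\lambda\,e^{\pi\overline{\lambda}z-\pi|\lambda|^{2}/2}\,S^{n}_{\Lambda}(z-\lambda),\qquad S^{n}_{\Lambda}(z)=e^{\pi|z|^{2}}\Big(\frac{d}{dz}\Big)^{n}\Big[e^{-\pi|z|^{2}}\frac{\sigma_\Lambda(z)^{n+1}}{n!\,z}\Big].$$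
   Context: Write $z=x+i\xi\in\mathbb{C}$, $\frac{d}{dz}=\frac12(\partial_x-i\partial_\xi)$, and $dz$ for area measure. $\mathcal{F}^{n+1}_2(\mathbb{C})$ (the true polyanalytic Fock space of order $n+1$) consists of all $F$ with $\int_{\mathbb{C}}|F(z)|^{2}e^{-\pi|z|^{2}}dz<\infty$ for which there is an entire function $H$ with $F(z)=\big(\frac{\pi^{n}}{n!}\big)^{1/2}e^{\pi|z|^{2}}\big(\frac{d}{dz}\big)^{n}\big[e^{-\pi|z|^{2}}H(z)\big]$, with the norm $\big(\int|F|^2e^{-\pi|z|^2}dz\big)^{1/2}$. A lattice is $\Lambda=\{m_1\omega_1+m_2\omega_2:m_1,m_2\in\mathbb{Z}\}$ with $\omega_1,\omega_2\in\mathbb{C}$ linearly independent over $\mathbb{R}$; $s(\Lambda)$ is the area of the parallelogram spanned by $\omega_1,\omega_2$. $\sigma(z)=z\prod_{\lambda\in\Lambda\setminus\{0\}}(1-\frac{z}{\lambda})e^{\frac{z}{\lambda}+\frac{z^{2}}{2\lambda^{2}}}$ is the Weierstrass sigma function of $\Lambda$, and $\sigma_\Lambda(z)=\sigma(z)e^{a z^{2}}$ is the modified sigma function, where $a=a(\Lambda)\in\mathbb{C}$ is a fixed constant chosen so that $|\sigma_\Lambda(z)|\le Ce^{\frac{\pi}{2s(\Lambda)}|z|^{2}}$ for all $z$. *)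

(* Defs.v *)
From HB Require Import structures.
From mathcomp Require Import all_boot all_order all_algebra.
From mathcomp Require Import all_classical all_reals all_analysis.
From mathcomp Require Import complex.
Set Implicit Arguments. Unset Strict Implicit. Unset Printing Implicit Defensive.
Import Order.TTheory GRing.Theory Num.Theory.
Local Open Scope ring_scope.

Definition cexp (R : realType) (z : R[i]) : R[i] :=
  Complex (expR (complex.Re z) * cos (complex.Im z)) (expR (complex.Re z) * sin (complex.Im z)).

Definition dx (R : realType) (f : R[i] -> R[i]) (z : R[i]) : R[i] :=
  Complex (derive1 (fun t : R => complex.Re (f (z + Complex t 0))) 0)
          (derive1 (fun t : R => complex.Im (f (z + Complex t 0))) 0).
Definition dxi (R : realType) (f : R[i] -> R[i]) (z : R[i]) : R[i] :=
  Complex (derive1 (fun t : R => complex.Re (f (z + Complex 0 t))) 0)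
          (derive1 (fun t : R => complex.Im (f (z + Complex 0 t))) 0).

Definition wirt (R : realType) (f : R[i] -> R[i]) (z : R[i]) : R[i] :=
  (Complex (2^-1) 0) * (dx f z - Complex 0 1 * dxi f z).
Definition wirtn (R : realType) (n : nat) (f : R[i] -> R[i]) : R[i] -> R[i] :=
  iter n (@wirt R) f.

Definition ccvg (R : realType) (u : nat -> R[i]) (l : R[i]) : Prop :=
  forall e : R, 0 < e -> exists N : nat, forall k : nat, (N <= k)%N ->
    Normc.normc (u k - l) < e.

Definition entire (R : realType) (H : R[i] -> R[i]) : Prop :=
  forall z : R[i], exists l : R[i], forall e : R, 0 < e -> exists d : R, 0 < d /\
    forall h : R[i], h != 0 -> Normc.normc h < d -> Normc.normc ((H (z + h) - H z) / h - l) < e.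

Definition latpt (R : realType) (w1 w2 : R[i]) (m1 m2 : int) : R[i] :=
  m1%:~R * w1 + m2%:~R * w2.

Definition area (R : realType) (w1 w2 : R[i]) : R :=
  `| complex.Re w1 * complex.Im w2 - complex.Im w1 * complex.Re w2 |.

Definition sumsq (R : realType) (N : nat) (g : int -> int -> R[i]) : R[i] :=
  \sum_(i < (2 * N).+1) \sum_(j < (2 * N).+1) g (i%:Z - N%:Z) (j%:Z - N%:Z).
Definition prodsq_nz (R : realType) (N : nat) (g : int -> int -> R[i]) : R[i] :=
  \prod_(i < (2 * N).+1) \prod_(j < (2 * N).+1 | ((i : nat), (j : nat)) != (N, N))
     g (i%:Z - N%:Z) (j%:Z - N%:Z).

Definition wfac (R : realType) (z l : R[i]) : R[i] :=
  (1 - z / l) * cexp (z / l + z ^+ 2 / (2%:R * l ^+ 2)).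

Definition l2 (R : realType) (c : int -> int -> R[i]) : Prop :=
  exists M : R, forall N : nat,
    \sum_(i < (2 * N).+1) \sum_(j < (2 * N).+1)
       Normc.normc (c (i%:Z - N%:Z) (j%:Z - N%:Z)) ^+ 2 <= M.

Definition lebC (R : realType) :=
  ((@lebesgue_measure R) \x (@lebesgue_measure R))%E.

Definition inFock (R : realType) (n : nat) (F : R[i] -> R[i]) : Prop :=
  (@lebC R).-integrable setT
     (fun p : R * R => ((Normc.normc (F (Complex p.1 p.2))) ^+ 2
                        * expR (- pi * (p.1 ^+ 2 + p.2 ^+ 2)))%:E)
  /\ exists H : R[i] -> R[i], entire H /\
     forall z : R[i],
       F z = Complex (Num.sqrt (pi ^+ n / (n`!)%:R)) 0
             * Complex (expR (pi * Normc.normc z ^+ 2)) 0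
             * wirtn n (fun w => Complex (expR (- pi * Normc.normc w ^+ 2)) 0 * H w) z.

(* S^n_Lambda, given q(z) = sigma(z)/z (the Weierstrass product) and the
   constant a, so that sigma_Lambda(z) = z q(z) e^{a z^2} and
   sigma_Lambda(z)^{n+1}/(n! z) = z^n (q(z) e^{a z^2})^{n+1} / n!  *)
Definition Sn (R : realType) (n : nat) (q : R[i] -> R[i]) (a : R[i]) (z : R[i]) : R[i] :=
  Complex (expR (pi * Normc.normc z ^+ 2)) 0
  * wirtn n (fun u => Complex (expR (- pi * Normc.normc u ^+ 2)) 0
                      * (u ^+ n * (q u * cexp (a * u ^+ 2)) ^+ n.+1 / (n`!)%:R)) z.

(* Main.v *)
(* Put g(z) = sigma_Lambda(z)^(n+1) / (n! z).  Since (n+1)/s < 1, the bound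
   |sigma_Lambda(z)|^(n+1) = O(exp((n+1) pi/(2 s) |z|^2)) leaves a factor
   exp(- delta |z - lambda|^2) in exp(- pi/2 |z|^2) times the modulated
   translate of g by lambda, so these translates sum to an entire function H.  The operator
   f |-> exp(pi |z|^2) (d/dz)^n [exp(- pi |z|^2) f] is covariant under these
   modulated translations; this turns the term of the series at lambda into the
   image of the term of H at lambda, and F into the image of H.
   Vanishing of order n+1 at the nonzero lattice points gives interpolation, and
   Cauchy-Schwarz with Fatou gives square integrability.

   Complex analysis is done without integration: the entire functions used here
   are locally uniform limits of polynomials, a class visibly closed under
   products, composition with polynomials and locally uniform limits.  Cauchy's
   estimates for polynomials follow by averaging over roots of unity, and pass to
   the limit. *)

Require Import Defs.
From HB Require Import structures.
From mathcomp Require Import all_boot all_order all_algebra.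
From mathcomp Require Import all_classical all_reals all_analysis.
From mathcomp Require Import complex.
From mathcomp Require Import cyclic cyclotomic separable measurable_realfun.
From mathcomp Require Import ring lra zify.
Import Order.TTheory GRing.Theory Num.Theory.
Import numFieldNormedType.Exports.
Local Open Scope ring_scope.

Set Implicit Arguments. Unset Strict Implicit. Unset Printing Implicit Defensive.

(** The normalisation distinguishes two kinds of points: g vanishes to order exactly n at the origin
    with leading coefficient 1/n!, so n derivatives leave the value 1, while elsewhere on the
    lattice a zero of order n+1 survives n derivatives. The image of H is not entire, since conj z
    enters at every step; estimates are made on entire functions and carried across by a recursion
    in which conj z is a constant for d/dz. Each step costs a factor |z| or a Cauchy estimate, hence
    an arbitrarily small increase of the Gaussian exponent; the strict inequality (n+1)/s < 1 pays
    for this and for the decay in |z - lambda|. The sigma product is given only as a pointwise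
    limit, which says nothing about differentiability; local uniformity comes from the factors being
    1 + O(|z/lambda|^3) and from the summability of |lambda|^-3. For square integrability, Gaussian
    lattice sums bounded uniformly in z act as in a Schur test: partial sums are dominated by
    Gaussians centred at lattice points with weights |a_lambda|^2, and the integral of such a
    Gaussian does not depend on its centre. *)

Local Notation nrm := Normc.normc.

(** * Moduli and Cauchy's coefficient estimate *)

Section Modulus.
Variable R : realType.
Implicit Types (z w x y : R[i]) (p : {poly R[i]}).

Lemma nrm_ge0 z : 0 <= nrm z.
Proof. by case: z => a b; rewrite /= sqrtr_ge0. Qed.

Lemma nrm0 : nrm (0 : R[i]) = 0. Proof. exact: Normc.normc0. Qed.
Lemma nrm1 : nrm (1 : R[i]) = 1. Proof. exact: Normc.normc1. Qed.

Lemma nrm_eq0 z : (nrm z == 0) = (z == 0).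
Proof.
by apply/eqP/eqP => [/Normc.eq0_normc//|->]; rewrite nrm0.
Qed.

Lemma nrm_gt0 z : (0 < nrm z) = (z != 0).
Proof. by rewrite lt_def nrm_ge0 andbT nrm_eq0. Qed.

Lemma nrmD x y : nrm (x + y) <= nrm x + nrm y. Proof. exact: le_normcD. Qed.
Lemma nrmN x : nrm (- x) = nrm x. Proof. exact: normcN. Qed.
Lemma nrmB x y : nrm (x - y) <= nrm x + nrm y.
Proof. by rewrite -(nrmN y); exact: nrmD. Qed.
Lemma nrmBC x y : nrm (x - y) = nrm (y - x).
Proof. by rewrite -nrmN opprB. Qed.
Lemma nrmM x y : nrm (x * y) = nrm x * nrm y. Proof. exact: Normc.normcM. Qed.
Lemma nrmV x : nrm x^-1 = (nrm x)^-1. Proof. exact: Normc.normcV. Qed.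
Lemma nrmX x n : nrm (x ^+ n) = nrm x ^+ n.
Proof. by elim: n => [|n IH]; rewrite ?expr0 ?nrm1// !exprS nrmM IH. Qed.

Lemma nrm_triB y x z : nrm (x - z) <= nrm (x - y) + nrm (y - z).
Proof. by have := nrmD (x - y) (y - z); rewrite addrA subrK. Qed.

Lemma nrm_leB x y : nrm x <= nrm y + nrm (x - y).
Proof. by have := nrmD y (x - y); rewrite addrC subrK. Qed.

Lemma nrm_sum (I : Type) (r : seq I) (P : pred I) (f : I -> R[i]) :
  nrm (\sum_(i <- r | P i) f i) <= \sum_(i <- r | P i) nrm (f i).
Proof.
elim/big_rec2 : _ => [|i a b _ H]; first by rewrite nrm0.
by apply: (le_trans (nrmD _ _)); rewrite lerD2l.
Qed.

Lemma nrm_real (r : R) : nrm (Complex r 0) = `|r|.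
Proof. by rewrite /= expr0n /= addr0 sqrtr_sqr. Qed.

Lemma natC n : (n%:R : R[i]) = Complex n%:R 0.
Proof. by rewrite -[RHS]/(real_complex R n%:R) rmorph_nat. Qed.

Lemma nrm_nat n : nrm (n%:R : R[i]) = n%:R.
Proof. by rewrite natC nrm_real ger0_norm. Qed.

Lemma nrm_sqr z : nrm z ^+ 2 = complex.Re z ^+ 2 + complex.Im z ^+ 2.
Proof. by case: z => a b; rewrite /= sqr_sqrtr // addr_ge0 ?sqr_ge0. Qed.

Lemma ReD x y : complex.Re (x + y) = complex.Re x + complex.Re y.
Proof. by case: x; case: y. Qed.
Lemma ImD x y : complex.Im (x + y) = complex.Im x + complex.Im y.
Proof. by case: x; case: y. Qed.
Lemma ReN x : complex.Re (- x) = - complex.Re x. Proof. by case: x. Qed.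
Lemma ImN x : complex.Im (- x) = - complex.Im x. Proof. by case: x. Qed.
Lemma ReM x y : complex.Re (x * y) =
  complex.Re x * complex.Re y - complex.Im x * complex.Im y.
Proof. by case: x; case: y. Qed.
Lemma ImM x y : complex.Im (x * y) =
  complex.Re x * complex.Im y + complex.Im x * complex.Re y.
Proof. by case: x; case: y. Qed.

Lemma complex_ext x y :
  complex.Re x = complex.Re y -> complex.Im x = complex.Im y -> x = y.
Proof. by case: x; case: y => /= a b c d -> ->. Qed.

Lemma ler_sqr2 (a b : R) : 0 <= b -> a ^+ 2 <= b ^+ 2 -> `|a| <= b.
Proof. by move=> b0 h; rewrite -ler_sqr ?nnegrE// real_normK// num_real. Qed.

Lemma nrm_Re z : `|complex.Re z| <= nrm z.
Proof. by apply: ler_sqr2; rewrite ?nrm_ge0// nrm_sqr lerDl sqr_ge0. Qed.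

Lemma nrm_Im z : `|complex.Im z| <= nrm z.
Proof. by apply: ler_sqr2; rewrite ?nrm_ge0// nrm_sqr lerDr sqr_ge0. Qed.

Lemma nrm_le_ReIm z : nrm z <= `|complex.Re z| + `|complex.Im z|.
Proof.
rewrite -[nrm z]ger0_norm ?nrm_ge0//; apply: ler_sqr2; first by rewrite addr_ge0.
rewrite nrm_sqr sqrrD !real_normK ?num_real// lerD2r lerDl.
by rewrite mulrn_wge0 // mulr_ge0.
Qed.

Lemma nrm_conj z : nrm (conjc z) = nrm z.
Proof. by case: z => a b; rewrite /= sqrrN. Qed.

(** ['X^n - 1] splits over the closed field and is separable in characteristic zero, so it has [n]
    distinct roots, among which a primitive one must occur. *)
Lemma prim_root_ex n : (0 < n)%N -> exists w : R[i], n.-primitive_root w.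
Proof.
move=> n0; have [r Dp] := closed_field_poly_normal ('X^n - 1 : {poly R[i]}).
move: Dp; rewrite lead_coefXnsubC // scale1r => Dp.
have sz_r : (n < (size r).+1)%N.
  by rewrite -(size_prod_XsubC r id) -Dp size_XnsubC.
have [||w] := hasP (has_prim_root n0 _ _ sz_r); last by exists w.
  by apply/allP => z; rewrite -root_prod_XsubC -Dp.
by rewrite -separable_prod_XsubC -Dp separable_Xn_sub_1 // pnatr_eq0 -lt0n.
Qed.

Lemma nrm_prim_root n w : (0 < n)%N -> n.-primitive_root w -> nrm w = 1.
Proof.
move=> n0 /prim_expr_order /(congr1 (@nrm R)); rewrite nrmX nrm1 => /eqP.
by rewrite pexpr_eq1 ?nrm_ge0 ?n0// => /eqP.
Qed.

Lemma sum_unity_root n w : w != 1 -> w ^+ n = 1 -> \sum_(j < n) w ^+ j = 0.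
Proof.
move=> w1 wn; have := subrX1 w n; rewrite wn subrr => /esym/eqP.
by rewrite mulf_eq0 subr_eq0 (negPf w1) => /eqP.
Qed.

(* Averaging over n-th roots of unity, with n larger than the degree,
   isolates a coefficient exactly, so no contour integral is needed. *)
Lemma coef_bound p (r M : R) k : 0 <= r ->
  (forall w, nrm w = r -> nrm p.[w] <= M) -> nrm p`_k * r ^+ k <= M.
Proof.
(* [n] also exceeds [k], so the weight w^(-jk) can be written with the natural exponent j(n - k). *)
move=> r0 pM; pose n := (size p + k.+1)%N.
have n0 : (0 < n)%N by rewrite /n addnS.
have kn : (k < n)%N by rewrite /n addnC leq_addr.
have [w wp] := prim_root_ex n0.
have w1 := nrm_prim_root n0 wp.
have key : \sum_(j < n) p.[Complex r 0 * w ^+ j] * w ^+ (j * (n - k)) =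
   n%:R * (p`_k * Complex r 0 ^+ k).
  under eq_bigr => j _.
    rewrite (@horner_coef_wide _ n) ?leq_addr// mulr_suml.
    under eq_bigr => i _.
      rewrite exprMn -exprM -!mulrA -exprD -mulnDr mulnC exprM mulrA.
      over.
    over.
  rewrite exchange_big /=.
  under eq_bigr => i _ do rewrite -mulr_sumr.
  rewrite (bigD1 (Ordinal kn)) //= subnKC ?(ltnW kn)//.
  rewrite (prim_expr_order wp).
  under eq_bigr => j _ do rewrite expr1n.
  rewrite sumr_const card_ord big1 ?addr0; first by rewrite mulrC.
  move=> i ik; rewrite sum_unity_root ?mulr0//; last first.
    by rewrite exprAC (prim_expr_order wp) expr1n.
  rewrite -(prim_order_dvd wp).
  (* Here 0 < i + (n - k) < 2n, so the only possible multiple of [n] is [n] itself, which forces i =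
     k. *)
  apply/negP => /dvdnP[q Hq]; move/eqP: ik; apply; apply/val_inj => /=.
  move: Hq; case: q => [|[|q]]; have := ltn_ord i; rewrite ?mulSn; lia.
have : nrm (n%:R * (p`_k * Complex r 0 ^+ k)) <= n%:R * M.
  rewrite -key; apply: (le_trans (nrm_sum _ _ _)).
  rewrite -[X in X%:R]card_ord mulr_natl -sumr_const; apply: ler_sum => j _.
  rewrite nrmM [X in _ * X]nrmX w1 expr1n mulr1; apply: pM.
  by rewrite nrmM nrmX w1 expr1n mulr1 nrm_real ger0_norm.
rewrite nrmM nrm_nat nrmM nrmX nrm_real ger0_norm// ler_pM2l// ltr0n//.
Qed.
End Modulus.

(** * Locally uniform limits of polynomials *)

Section Limits.
Variable R : realType.
Implicit Types (e r M : R).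

Lemma invS_small e : 0 < e -> exists N : nat, forall k, (N <= k)%N ->
  (k.+1%:R)^-1 <= e.
Proof.
move=> e0; exists (Num.bound e^-1) => k Nk.
rewrite -[leRHS]invrK lef_pV2 ?posrE ?invr_gt0 ?ltr0n//.
apply: (le_trans (ltW (archi_boundP _))); first by rewrite invr_ge0 ltW.
by rewrite ler_nat (leq_trans Nk).
Qed.

Lemma rcauchy (u : nat -> R) :
  (forall e, 0 < e -> exists N, forall k l, (N <= k)%N -> (N <= l)%N ->
     `|u k - u l| <= e) ->
  exists l : R, forall e, 0 < e -> exists N, forall k, (N <= k)%N ->
     `|u k - l| <= e.
Proof.
move=> uC; have : cvg (u @ \oo)%classic.
  apply/cauchy_cvgP/cauchyP => e e0.
  have [N uN] := uC (e / 2) (divr_gt0 e0 (ltr0Sn _ 1)).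
  exists (u N); exists N => //= k Nk; rewrite /ball/=.
  by apply: (le_lt_trans (uN _ _ _ _)) => //; lra.
move=> /cvg_ex[l /cvgrPdist_le ul]; exists l => e /ul[N _ uN].
by exists N => k Nk; rewrite distrC; exact: uN.
Qed.

Lemma ccauchy (u : nat -> R[i]) :
  (forall e, 0 < e -> exists N, forall k l, (N <= k)%N -> (N <= l)%N ->
     nrm (u k - u l) <= e) ->
  exists l : R[i], forall e, 0 < e -> exists N, forall k, (N <= k)%N ->
     nrm (u k - l) <= e.
Proof.
move=> uC.
have [a ua] : exists l : R, forall e, 0 < e -> exists N, forall k, (N <= k)%N ->
     `|complex.Re (u k) - l| <= e.
  apply: rcauchy => e /uC[N uN]; exists N => k l Nk Nl.
  by rewrite -ReN -ReD; apply: le_trans (nrm_Re _) _; exact: uN.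
have [b ub] : exists l : R, forall e, 0 < e -> exists N, forall k, (N <= k)%N ->
     `|complex.Im (u k) - l| <= e.
  apply: rcauchy => e /uC[N uN]; exists N => k l Nk Nl.
  by rewrite -ImN -ImD; apply: le_trans (nrm_Im _) _; exact: uN.
exists (Complex a b) => e e0.
have e2 : 0 < e / 2 by lra.
have [N1 h1] := ua _ e2; have [N2 h2] := ub _ e2.
exists (maxn N1 N2) => k; rewrite geq_max => /andP[k1 k2].
apply: (le_trans (nrm_le_ReIm _)); rewrite ReD ImD ReN ImN /=.
by have := h1 _ k1; have := h2 _ k2; lra.
Qed.

Lemma lim_nrm_le (u : nat -> R[i]) l a M N0 :
  (forall e, 0 < e -> exists N, forall k, (N <= k)%N -> nrm (u k - l) <= e) ->
  (forall k, (N0 <= k)%N -> nrm (u k - a) <= M) -> nrm (l - a) <= M.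
Proof.
move=> ul uM; apply/ler_addgt0Pr => e /ul[N uN].
apply: (le_trans (nrm_triB (u (maxn N N0)) _ _)); rewrite addrC.
by rewrite lerD ?uM ?leq_maxr// nrmBC uN ?leq_maxl.
Qed.

Definition lucvg (fs : nat -> R[i] -> R[i]) (f : R[i] -> R[i]) :=
  forall r e, 0 < e -> exists N, forall k, (N <= k)%N ->
    forall z, nrm z <= r -> nrm (fs k z - f z) <= e.

Lemma lucauchy (fs : nat -> R[i] -> R[i]) :
  (forall r e, 0 < e -> exists N, forall k l, (N <= k)%N -> (N <= l)%N ->
    forall z, nrm z <= r -> nrm (fs k z - fs l z) <= e) ->
  exists f, lucvg fs f.
Proof.
move=> fC.
have /choice[f ff] : forall z, exists l : R[i], forall e, 0 < e ->
    exists N, forall k, (N <= k)%N -> nrm (fs k z - l) <= e.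
  move=> z; apply: ccauchy => e /(fC (nrm z))[N fN]; exists N => k l Nk Nl.
  exact: fN.
exists f => r e /(fC r)[N fN]; exists N => k Nk z zr.
rewrite nrmBC; apply: (@lim_nrm_le (fs ^~ z) _ _ _ N) (ff z) _ => l Nl.
exact: fN.
Qed.

Lemma lucvg_pt fs f z : lucvg fs f ->
  forall e, 0 < e -> exists N, forall k, (N <= k)%N -> nrm (fs k z - f z) <= e.
Proof.
by move=> h e /(h (nrm z))[N hN]; exists N => k Nk; exact: hN.
Qed.

Lemma lucvg_ccvg fs f z : lucvg fs f -> ccvg (fs ^~ z) (f z).
Proof.
move=> h e e0; have [|N hN] := lucvg_pt z h (e := e / 2); first by lra.
by exists N => k /hN; lra.
Qed.

Lemma ccvg_uniq (u : nat -> R[i]) l m : ccvg u l -> ccvg u m -> l = m.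
Proof.
move=> ul um; apply/eqP; rewrite -subr_eq0 -nrm_eq0 eq_le nrm_ge0 andbT.
apply/ler_addgt0Pr => e e0; rewrite add0r; have [N hN] := um _ e0.
apply: (@lim_nrm_le u _ _ _ N) => [e' /ul[N' uN]|k Nk].
  by exists N' => k /uN/ltW.
exact/ltW/hN.
Qed.

End Limits.

Section Polylim.
Variable R : realType.
Implicit Types (z w h : R[i]) (p : {poly R[i]}) (r e M : R) (f g : R[i] -> R[i]).

Lemma poly_bounded p r : exists M, 0 <= M /\
  forall z, nrm z <= r -> nrm p.[z] <= M.
Proof.
elim/poly_ind: p => [|p c [M [M0 pM]]].
  by exists 0; split=> // z _; rewrite horner0 nrm0.
exists (M * `|r| + nrm c); split; first by rewrite addr_ge0 ?mulr_ge0 ?nrm_ge0.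
move=> z zr; rewrite hornerMXaddC; apply: (le_trans (nrmD _ _)).
rewrite lerD2r nrmM ler_pM ?nrm_ge0 ?pM//; exact: le_trans zr (ler_norm r).
Qed.

Section Translate.
Variables (p : {poly R[i]}) (z : R[i]).
Let s := p \Po ('X + z%:P).

Let s0 : s`_0 = p.[z].
Proof. by rewrite -horner_coef0 horner_comp !hornerE. Qed.
Let s1 : s`_1 = p^`().[z].
Proof.
have <- : s^`().[0] = s`_1 by rewrite horner_coef0 coef_deriv.
by rewrite deriv_comp derivD derivX derivC addr0 mulr1 horner_comp !hornerE.
Qed.
Let sE h : s.[h] = p.[z + h].
Proof. by rewrite horner_comp !hornerE addrC. Qed.

(** Cauchy's estimate for the degree-one coefficient of the polynomial recentred at [z]. *)
Lemma poly_deriv_bound r M : 0 < r ->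
  (forall w, nrm (w - z) <= r -> nrm p.[w] <= M) -> nrm p^`().[z] <= M / r.
Proof.
move=> r0 pM; rewrite ler_pdivlMr// -s1 -[X in _ * X]expr1.
apply: coef_bound => [|w wr]; first exact: ltW.
by rewrite sE; apply: pM; rewrite addrC addKr wr.
Qed.

(** The recentred coefficient of degree i+2 is at most M / r^(i+2), and |h|/r <= 1/2 makes the tail
    a geometric series of sum at most 2. The constant is independent of the degree, so the bound
    survives limits of polynomials. *)
Lemma poly_taylor_bound r M h : 0 < r ->
  (forall w, nrm (w - z) <= r -> nrm p.[w] <= M) -> nrm h <= r / 2 ->
  nrm (p.[z + h] - p.[z] - p^`().[z] * h) <= 2 * M * (nrm h / r) ^+ 2.
Proof.
move=> r0 pM hr.
have M0 : 0 <= M.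
  by apply: le_trans (nrm_ge0 p.[z]) (pM _ _); rewrite subrr nrm0 ltW.
have x0 : 0 <= nrm h / r by rewrite divr_ge0 ?nrm_ge0 ?ltW.
have x12 : nrm h / r <= 2^-1 by rewrite ler_pdivrMr// mulrC.
rewrite -sE -s0 -s1 (@horner_coef_wide _ (size s).+2)//; last first.
  by rewrite -addn2 leq_addr.
rewrite !big_ord_recl /= expr0 expr1 mulr1.
rewrite (_ : forall a b c : R[i], a + (b + c) - a - b = c); last by move=> *; ring.
apply: (le_trans (nrm_sum _ _ _)).
apply: (@le_trans _ _ (\sum_(i < size s) (M * (nrm h / r) ^+ 2 * 2^-1 ^+ i))).
  apply: ler_sum => i _; rewrite nrmM nrmX.
  rewrite /bump !leq0n !add1n.
  have b1 : nrm s`_i.+2 * r ^+ i.+2 <= M.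
    apply: coef_bound => [|w wr]; first exact: ltW.
    by rewrite sE; apply: pM; rewrite addrC addKr wr.
  have b2 : (nrm h / r) ^+ i <= 2^-1 ^+ i by rewrite lerXn2r ?nnegrE ?invr_ge0.
  have -> : nrm h ^+ i.+2 = r ^+ i.+2 * ((nrm h / r) ^+ 2 * (nrm h / r) ^+ i).
    by rewrite -exprD add2n -exprMn mulrCA divff ?mulr1// gt_eqF.
  rewrite mulrA -[leRHS]mulrA.
  have c1 : 0 <= nrm s`_i.+2 * r ^+ i.+2.
    by rewrite mulr_ge0 ?nrm_ge0// exprn_ge0// ltW.
  have c2 : 0 <= (nrm h / r) ^+ 2 * (nrm h / r) ^+ i by rewrite mulr_ge0 ?exprn_ge0.
  apply: ler_pM => //; apply: ler_wpM2l => //; exact: exprn_ge0.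
have -> : 2 * M * (nrm h / r) ^+ 2 = M * (nrm h / r) ^+ 2 * 2 by ring.
rewrite -mulr_sumr; apply: ler_wpM2l; first by rewrite mulr_ge0// exprn_ge0.
have := subrX1 (2^-1 : R) (size s).
have : 0 <= (2^-1 : R) ^+ size s by rewrite exprn_ge0.
move: (_ ^+ size s) (\sum_(i < size s) _) => x y; lra.
Qed.

End Translate.

Definition polylim f := forall r e, 0 < e -> exists p : {poly R[i]},
  forall z, nrm z <= r -> nrm (f z - p.[z]) <= e.

Lemma polylim_horner p : polylim (horner p).
Proof. by move=> r e e0; exists p => z _; rewrite subrr nrm0 ltW. Qed.

Lemma polylim_cst c : polylim (fun=> c).
Proof.
by move=> r e e0; exists c%:P => z _; rewrite hornerC subrr nrm0 ltW.
Qed.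

Lemma polylim_id : polylim id.
Proof. by move=> r e e0; exists 'X => z _; rewrite hornerX subrr nrm0 ltW. Qed.

Lemma polylim_bounded f r : polylim f -> exists M, 0 <= M /\
  forall z, nrm z <= r -> nrm (f z) <= M.
Proof.
move=> /(_ r 1 ltr01)[p fp]; have [M [M0 pM]] := poly_bounded p r.
exists (M + 1); split=> [|z zr]; first by rewrite addr_ge0.
apply: (le_trans (nrm_leB _ p.[z])); exact: lerD (pM _ zr) (fp _ zr).
Qed.

Lemma polylimD f g : polylim f -> polylim g -> polylim (fun z => f z + g z).
Proof.
move=> fE gE r e e0; have e2 : 0 < e / 2 by lra.
have [p fp] := fE r _ e2; have [q gq] := gE r _ e2.
exists (p + q) => z zr; rewrite hornerD opprD addrACA.
by apply: (le_trans (nrmD _ _)); have := fp _ zr; have := gq _ zr; lra.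
Qed.

Lemma polylimM f g : polylim f -> polylim g -> polylim (fun z => f z * g z).
Proof.
move=> fE gE r e e0.
have [M [M0 fM]] := polylim_bounded r fE; have [M' [M'0 gM]] := polylim_bounded r gE.
have D1 : 0 < M' + 1 by lra.
have [p fp] := fE r (e / 2 / (M' + 1)) ltac:(apply: divr_gt0; lra).
have [M2 [M20 pM]] := poly_bounded p r.
have D2 : 0 < M2 + 1 by lra.
have [q gq] := gE r (e / 2 / (M2 + 1)) ltac:(apply: divr_gt0; lra).
exists (p * q) => z zr; rewrite hornerM.
have -> : f z * g z - p.[z] * q.[z] = (f z - p.[z]) * g z + p.[z] * (g z - q.[z]).
  by ring.
apply: (le_trans (nrmD _ _)); rewrite !nrmM.
have h1 : nrm (f z - p.[z]) * nrm (g z) <= e / 2 / (M' + 1) * (M' + 1).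
  by rewrite ler_pM ?nrm_ge0 ?fp//; have := gM _ zr; lra.
have h2 : nrm p.[z] * nrm (g z - q.[z]) <= (M2 + 1) * (e / 2 / (M2 + 1)).
  by rewrite ler_pM ?nrm_ge0 ?gq//; have := pM _ zr; lra.
move: h1 h2; rewrite divfK ?gt_eqF// mulrCA divff ?gt_eqF// mulr1; lra.
Qed.

Lemma polylimX f n : polylim f -> polylim (fun z => f z ^+ n).
Proof.
move=> fE; elim: n => [|n IH]; first exact: polylim_cst.
under eq_fun do rewrite exprS; exact: polylimM.
Qed.

Lemma polylim_comp f p : polylim f -> polylim (fun z => f p.[z]).
Proof.
move=> fE r e e0; have [M [_ pM]] := poly_bounded p r.
have [q fq] := fE M _ e0; exists (q \Po p) => z zr.
by rewrite horner_comp; exact/fq/pM.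
Qed.

Lemma polylim_sum (I : Type) (s : seq I) (P : pred I) (F : I -> R[i] -> R[i]) :
  (forall i, polylim (F i)) -> polylim (fun z => \sum_(i <- s | P i) F i z).
Proof.
move=> FE; elim: s => [|i s IH].
  by under eq_fun do rewrite big_nil; exact: polylim_cst.
under eq_fun do rewrite big_cons; case: (P i) => //; exact: polylimD.
Qed.

Lemma polylim_prod (I : Type) (s : seq I) (P : pred I) (F : I -> R[i] -> R[i]) :
  (forall i, polylim (F i)) -> polylim (fun z => \prod_(i <- s | P i) F i z).
Proof.
move=> FE; elim: s => [|i s IH].
  by under eq_fun do rewrite big_nil; exact: polylim_cst.
under eq_fun do rewrite big_cons; case: (P i) => //; exact: polylimM.
Qed.

Lemma polylim_lucvg fs f : (forall k, polylim (fs k)) -> lucvg fs f -> polylim f.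
Proof.
move=> fsE fsf r e e0; have e2 : 0 < e / 2 by lra.
have [N fN] := fsf r _ e2; have [p fp] := fsE N r _ e2; exists p => z zr.
apply: (le_trans (nrm_triB (fs N z) _ _)); rewrite nrmBC.
by have := fN N (leqnn _) _ zr; have := fp _ zr; lra.
Qed.

(** A quadratic remainder in place of o(h): it is what the Taylor bound supplies, and it turns the
    chain rule and the restriction to real lines into plain inequalities. No sign is imposed on [C],
    hence the absolute values taken later. *)
Definition cder f z l := exists C d, 0 < d /\
  forall h, nrm h < d -> nrm (f (z + h) - f z - l * h) <= C * nrm h ^+ 2.

Lemma polylim_seq f : polylim f -> exists p_ : nat -> {poly R[i]},
  forall k z, nrm z <= k%:R -> nrm (f z - (p_ k).[z]) <= (k.+1%:R)^-1.
Proof.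
move=> fE.
have /choice[p_ fp] : forall k : nat, exists p : {poly R[i]},
    forall z, nrm z <= k%:R -> nrm (f z - p.[z]) <= (k.+1%:R)^-1.
  by move=> k; apply: fE; rewrite invr_gt0 ltr0n.
by exists p_.
Qed.

Lemma polylim_seq_lucvg f (p_ : nat -> {poly R[i]}) :
  (forall k z, nrm z <= k%:R -> nrm (f z - (p_ k).[z]) <= (k.+1%:R)^-1) ->
  lucvg (fun k => horner (p_ k)) f.
Proof.
move=> fp r e e0; have [N hN] := invS_small e0.
exists (maxn N (Num.bound `|r|)) => k; rewrite geq_max => /andP[Nk rk] z zr.
rewrite nrmBC; apply: le_trans (hN _ Nk); apply: fp; apply: (le_trans zr).
apply: (le_trans (ler_norm r)); apply: (le_trans (ltW (archi_boundP _))) => //.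
by rewrite ler_nat.
Qed.

(** The derivatives of approximating polynomials are locally uniformly Cauchy by Cauchy's estimate
    applied to differences. Their limit inherits the Taylor remainder and Cauchy's estimate because
    the constants in both are free of the degree. *)
Theorem polylim_deriv f : polylim f -> exists f', [/\ polylim f',
  forall z, cder f z (f' z) &
  forall z r M, 0 < r -> (forall w, nrm (w - z) <= r -> nrm (f w) <= M) ->
    nrm (f' z) <= M / r].
Proof.
move=> fE; have [p_ /polylim_seq_lucvg pf] := polylim_seq fE.
have [f' pf'] : exists f', lucvg (fun k => horner (p_ k)^`()) f'.
  apply: lucauchy => r e e0; have e2 : 0 < e / 2 by lra.
  (* The extra unit of radius leaves room for Cauchy's estimate on unit discs. *)
  have [N hN] := pf (r + 1) _ e2; exists N => k l Nk Nl z zr.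
  rewrite -hornerN -hornerD -derivN -derivD -[e]divr1.
  apply: poly_deriv_bound => // w wz.
  have wr : nrm w <= r + 1.
    by apply: (le_trans (nrm_leB _ z)); rewrite lerD.
  rewrite hornerD hornerN; apply: (le_trans (nrm_triB (f w) _ _)).
  by have := hN _ Nk _ wr; have := hN _ Nl _ wr; rewrite [nrm (_ - f w)]nrmBC; lra.
exists f'; split.
- by apply: polylim_lucvg pf' => k; exact: polylim_horner.
- move=> z; have [M [M0 fM]] := polylim_bounded (nrm z + 1) fE.
  exists (2 * (M + 1)), 2^-1; split=> // h h2.
  have [N hN] := pf (nrm z + 1) 1 ltr01.
  apply/ler_addgt0Pr => e e0.
  have e4 : 0 < e / 4 by lra.
  have [N1 h1] := pf (nrm z + 1) _ e4; have [N2 h'] := pf' (nrm z + 1) _ e4.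
  pose k := maxn N (maxn N1 N2).
  have kN : (N <= k)%N by rewrite leq_maxl.
  have kN1 : (N1 <= k)%N by rewrite /k leq_max [(_ <= maxn _ _)%N]leq_max leqnn orbT.
  have kN2 : (N2 <= k)%N by rewrite /k leq_max [(_ <= maxn _ _)%N]leq_max leqnn !orbT.
  have zz : nrm z <= nrm z + 1 by lra.
  have zh : nrm (z + h) <= nrm z + 1 by apply: (le_trans (nrmD _ _)); lra.
  (* The first summand is the Taylor remainder of an approximant; the others are approximation
     errors that together stay below the arbitrary [e]. *)
  have -> : f (z + h) - f z - f' z * h =
     ((p_ k).[z + h] - (p_ k).[z] - (p_ k)^`().[z] * h)
     + ((f (z + h) - (p_ k).[z + h]) + ((p_ k).[z] - f z)
       + ((p_ k)^`().[z] - f' z) * h) by ring.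
  apply: (le_trans (nrmD _ _)); apply: lerD.
    have := @poly_taylor_bound (p_ k) z 1 (M + 1) h ltr01; rewrite divr1.
    apply; last by lra.
    move=> w wz; have wr : nrm w <= nrm z + 1.
      by apply: (le_trans (nrm_leB _ z)); rewrite lerD2l.
    apply: (le_trans (nrm_leB _ (f w))); apply: lerD; first exact: fM.
    exact: hN.
  apply: (le_trans (nrmD _ _)); rewrite nrmM.
  have a1 := h1 _ kN1 _ zz; have a2 := h1 _ kN1 _ zh; have a3 := h' _ kN2 _ zz.
  have a4 : nrm ((p_ k)^`().[z] - f' z) * nrm h <= e / 4 * 1.
    by rewrite ler_pM ?nrm_ge0//; lra.
  have := nrmD (f (z + h) - (p_ k).[z + h]) ((p_ k).[z] - f z).
  by rewrite [nrm (f _ - _)]nrmBC; lra.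
- move=> z r M r0 fM; rewrite -[f' z]subr0.
  apply/ler_addgt0Pr => e e0.
  have er : 0 < e * r by rewrite mulr_gt0.
  have [N hN] := pf (nrm z + r) _ er.
  apply: (@lim_nrm_le _ (fun k => (p_ k)^`().[z]) _ _ _ N).
    exact: (lucvg_pt z pf').
  move=> k Nk; rewrite subr0.
  have -> : M / r + e = (M + e * r) / r by rewrite mulrDl mulfK ?gt_eqF.
  apply: poly_deriv_bound => // w wz.
  apply: (le_trans (nrm_leB _ (f w))); rewrite lerD ?fM// hN//.
  by apply: (le_trans (nrm_leB _ z)); rewrite lerD2l.
Qed.

End Polylim.

(** * The complex exponential *)

Section RealCalculus.
Variable R : realType.
Implicit Types (x y t a : R) (f g : R -> R).

Lemma is_derive_quad f x a C d : 0 < d ->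
  (forall h, `|h| < d -> `|f (x + h) - f x - a * h| <= C * h ^+ 2) ->
  is_derive x (1 : R) f a.
Proof.
move=> d0 fq.
have key : (h^-1 *: ((f \o shift x) (h *: (1 : R)) - f x) @[h --> 0^'] --> a)%classic.
  apply/cvgrPdist_le => e e0.
  have dC : 0 < Num.min d (e / (`|C| + 1)).
    by rewrite lt_min d0 divr_gt0// ltr_wpDl.
  near=> h.
  have h0 : h != 0 by near: h; exact: nbhs_dnbhs_neq.
  have : `|h| < Num.min d (e / (`|C| + 1)).
    near: h; apply: dnbhs0_lt; exact: dC.
  rewrite lt_min => /andP[hd he].
  rewrite /= /shift /= [_ *: 1]mulr1 [h + x]addrC.
  have -> : a - h^-1 *: (f (x + h) - f x) = - (h^-1 * (f (x + h) - f x - a * h)).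
    by rewrite /GRing.scale /=; field.
  rewrite normrN normrM normfV.
  rewrite mulrC ler_pdivrMr ?normr_gt0//.
  apply: (le_trans (fq _ hd)); rewrite -real_normK ?num_real// expr2 mulrA.
  rewrite ler_wpM2r//; apply: (@le_trans _ _ ((`|C| + 1) * `|h|)).
    rewrite ler_wpM2r//; have := ler_norm C; lra.
  by rewrite mulrC -ler_pdivlMr ?ltW// ltr_wpDl.
apply: DeriveDef; first by apply/cvg_ex; exists a.
by apply: cvg_lim => //; exact: key.
Unshelve. all: by end_near. Qed.

Lemma mvt_bound f (df : R -> R) M a b : a <= b ->
  (forall x, is_derive x (1 : R) f (df x)) ->
  (forall x, a <= x <= b -> `|df x| <= M) -> `|f b - f a| <= M * (b - a).
Proof.
move=> ab fd dfM.
have fc : {within `[a, b], continuous f}%classic.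
  by apply: derivable_within_continuous => x _; exact: ex_derive.
have [c] := MVT_segment ab (fun x _ => fd x) fc.
rewrite in_itv /= => cab ->; rewrite normrM [`|b - a|]ger0_norm ?subr_ge0//.
by rewrite ler_wpM2r ?subr_ge0// dfM.
Qed.

Lemma norm_sin_le x : `|sin x| <= `|x|.
Proof.
wlog x0 : x / 0 <= x.
  move=> H; have [/H//|/ltW x0] := leP 0 x.
  by rewrite -normrN -sinN -[leRHS]normrN H// oppr_ge0.
have := mvt_bound (M := 1) x0 (@is_derive_sin R) (fun y _ => cos_max y).
by rewrite sin0 !subr0 mul1r [`|x|]ger0_norm.
Qed.

Lemma norm_cosB1_le x : `|cos x - 1| <= x ^+ 2.
Proof.
have -> : cos x - 1 = - (sin (x / 2) ^+ 2 *+ 2).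
  rewrite {1}(_ : x = (x / 2) *+ 2); last by rewrite mulr2n; lra.
  have := cos2Dsin2 (x / 2); rewrite cos_mulr2n !mulr2n; lra.
rewrite normrN normrMn normrX mulr2n.
have : `|sin (x / 2)| ^+ 2 <= (x / 2) ^+ 2.
  by rewrite -[leRHS]real_normK ?num_real// lerXn2r ?nnegrE// norm_sin_le.
have := sqr_ge0 x; rewrite exprMn; lra.
Qed.

Lemma norm_sinB_le x : `|sin x - x| <= `|x| ^+ 3.
Proof.
wlog x0 : x / 0 <= x.
  move=> H; have [/H//|/ltW x0] := leP 0 x.
  have -> : `|sin x - x| = `|sin (- x) - (- x)| by rewrite sinN -opprD normrN.
  by rewrite -[`|x|]normrN H// oppr_ge0.
have dd y : is_derive y (1 : R) (fun z => sin z - z) (cos y - 1).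
  by apply: is_deriveB.
have := mvt_bound (M := x ^+ 2) x0 dd; rewrite sin0 !subr0 [`|x|]ger0_norm//.
rewrite -exprSr; apply => y /andP[y0 yx].
apply: (le_trans (norm_cosB1_le _)).
by rewrite lerXn2r ?nnegrE.
Qed.

(** The upper bound needs no series: 1 - x <= exp(-x) gives exp(x)(1 - x) <= 1. *)
Lemma expR_quad x : `|x| <= 2^-1 -> `|expR x - 1 - x| <= 2 * x ^+ 2.
Proof.
rewrite ler_norml => /andP[x1 x2].
have lo := expR_ge1Dx x.
have hi : expR x * (1 - x) <= 1.
  have := expR_ge1Dx (- x).
  rewrite -(ler_pM2l (expR_gt0 x)) -expRD subrr expR0; lra.
have e0 := expR_gt0 x.
by rewrite ger0_norm; nra.
Qed.

End RealCalculus.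

Section ComplexExp.
Variable R : realType.
Implicit Types (z w h : R[i]).

Lemma cexpD z w : cexp (z + w) = cexp z * cexp w.
Proof.
apply: complex_ext; rewrite ?ReM ?ImM /cexp /= ReD ImD expRD ?cosD ?sinD; ring.
Qed.

Lemma cexp0 : cexp (0 : R[i]) = 1.
Proof. by rewrite /cexp /= expR0 cos0 sin0 mulr1 mulr0. Qed.

Lemma nrm_cexp z : nrm (cexp z) = expR (complex.Re z).
Proof.
rewrite /cexp /= !exprMn -mulrDr cos2Dsin2 mulr1 sqrtr_sqr.
by rewrite ger0_norm ?expR_ge0.
Qed.

Lemma cexp_real (r : R) : cexp (Complex r 0) = Complex (expR r) 0.
Proof. by rewrite /cexp /= cos0 sin0 mulr1 mulr0. Qed.

(** The constant 8 is generous: the errors in the real and imaginary parts add up to at most 3x^2 +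
    4y^2. *)
Lemma cexp_quad h : nrm h <= 2^-1 -> nrm (cexp h - 1 - h) <= 8 * nrm h ^+ 2.
Proof.
move=> h2.
have := nrm_Re h; have := nrm_Im h; rewrite [nrm h ^+ 2]nrm_sqr.
set x := complex.Re h; set y := complex.Im h => yn xn.
have x2 : `|x| <= 2^-1 by apply: le_trans h2.
have y2 : `|y| <= 2^-1 by apply: le_trans h2.
apply: (le_trans (nrm_le_ReIm _)); rewrite !(ReD, ImD, ReN, ImN) /cexp /= -/x -/y subr0.
have e1 := expR_quad x2.
have e2 : expR x <= 2.
  have := sqr_ge0 x; have : x ^+ 2 <= (2^-1) ^+ 2.
    by rewrite -real_normK ?num_real// lerXn2r ?nnegrE ?invr_ge0.
  by move: e1 x2; rewrite !ler_norml => /andP[_ ?] /andP[? ?]; lra.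
have e0 := expR_gt0 x.
have c1 := norm_cosB1_le y; have s1 := norm_sin_le y; have s2 := norm_sinB_le y.
have A : `|expR x * cos y - 1 - x| <= 2 * x ^+ 2 + 2 * y ^+ 2.
  have -> : expR x * cos y - 1 - x = (expR x - 1 - x) + expR x * (cos y - 1) by ring.
  apply: (le_trans (ler_normD _ _)); apply: lerD => //.
  by rewrite normrM ger0_norm ?expR_ge0// ler_pM// expR_ge0.
have B : `|expR x * sin y - y| <= 2 * `|x| * `|y| + y ^+ 2.
  have -> : expR x * sin y - y = (expR x - 1) * sin y + (sin y - y) by ring.
  apply: (le_trans (ler_normD _ _)); apply: lerD.
    rewrite normrM ler_pM//.
    have := ler_normD (expR x - 1 - x) x; rewrite subrK.
    have : x ^+ 2 <= 2^-1 * `|x|.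
      by rewrite -real_normK ?num_real// expr2 ler_wpM2r.
    by lra.
  apply: (le_trans s2); rewrite -[y ^+ 2]real_normK ?num_real// exprS.
  by rewrite ler_piMl ?exprn_ge0//; lra.
have C : 2 * `|x| * `|y| <= x ^+ 2 + y ^+ 2.
  have := sqr_ge0 (`|x| - `|y|).
  by rewrite sqrrB !real_normK ?num_real// mulr2n; lra.
have := sqr_ge0 x; have := sqr_ge0 y.
by lra.
Qed.

End ComplexExp.

(** * Wirtinger derivatives *)

#[local] Arguments Normc.normc : simpl never.

Section Wirtinger.
Variable R : realType.
Implicit Types (z w h l : R[i]) (f g : R[i] -> R[i]) (t : R).

Definition cpath_deriv (u : R -> R[i]) t (a : R[i]) :=
  is_derive t (1 : R) (fun s => complex.Re (u s)) (complex.Re a) /\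
  is_derive t (1 : R) (fun s => complex.Im (u s)) (complex.Im a).

Lemma cpath_derivD (u v : R -> R[i]) t a b :
  cpath_deriv u t a -> cpath_deriv v t b -> cpath_deriv (fun s => u s + v s) t (a + b).
Proof.
move=> [u1 u2] [v1 v2]; split; rewrite ?ReD ?ImD.
- under eq_fun do rewrite ReD; exact: is_deriveD.
- under eq_fun do rewrite ImD; exact: is_deriveD.
Qed.

Lemma is_deriveM_eq (f g : R -> R) t a b c : is_derive t (1 : R) f a ->
  is_derive t (1 : R) g b -> c = a * g t + f t * b ->
  is_derive t (1 : R) (fun s => f s * g s) c.
Proof.
move=> fa gb ->; have := is_deriveM fa gb.
by rewrite addrC [g t *: _]mulrC.
Qed.

Lemma cpath_derivM (u v : R -> R[i]) t a b :
  cpath_deriv u t a -> cpath_deriv v t b ->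
  cpath_deriv (fun s => u s * v s) t (a * v t + u t * b).
Proof.
move=> [u1 u2] [v1 v2]; split; rewrite ?ReD ?ImD !(ReM, ImM).
- under eq_fun do rewrite ReM.
  apply: (is_derive_eq (is_deriveB (is_deriveM_eq u1 v1 erefl)
    (is_deriveM_eq u2 v2 erefl))); ring.
- under eq_fun do rewrite ImM.
  apply: (is_derive_eq (is_deriveD (is_deriveM_eq u1 v2 erefl)
    (is_deriveM_eq u2 v1 erefl))); ring.
Qed.

(** [wirt] is built from total real derivatives, so its value alone does not say that they exist.
    This relation carries existence, which makes the sum and product rules available for
    non-holomorphic factors such as [conjc] and the Gaussian. *)
Definition is_wirt f z l := exists a b : R[i],
  [/\ cpath_deriv (fun t => f (z + Complex t 0)) 0 a,
      cpath_deriv (fun t => f (z + Complex 0 t)) 0 b &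
      l = Complex 2^-1 0 * (a - Complex 0 1 * b)].

Lemma is_wirtE f z l : is_wirt f z l -> wirt f z = l.
Proof.
move=> [a [b [[a1 a2] [b1 b2] ->]]]; rewrite /wirt /dx /dxi !derive1E.
by rewrite !derive_val; case: a {a1 a2}; case: b {b1 b2}.
Qed.

Lemma is_wirtD f g z l m : is_wirt f z l -> is_wirt g z m ->
  is_wirt (fun w => f w + g w) z (l + m).
Proof.
move=> [a [b [fa fb ->]]] [a' [b' [ga gb ->]]].
exists (a + a'), (b + b'); split; last by ring.
- exact: (cpath_derivD fa ga).
- exact: (cpath_derivD fb gb).
Qed.

Lemma is_wirtM f g z l m : is_wirt f z l -> is_wirt g z m ->
  is_wirt (fun w => f w * g w) z (l * g z + f z * m).
Proof.
move=> [a [b [fa fb ->]]] [a' [b' [ga gb ->]]].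
exists (a * g z + f z * a'), (b * g z + f z * b'); split; last by ring.
- by have := cpath_derivM fa ga; rewrite addr0.
- by have := cpath_derivM fb gb; rewrite addr0.
Qed.

Lemma cpath_deriv_cst t c : cpath_deriv (fun=> c) t 0.
Proof. by split; apply: is_derive_cst. Qed.

Lemma is_wirt_cst c z : is_wirt (fun=> c) z 0.
Proof.
exists 0, 0; split; last (by ring); exact: cpath_deriv_cst.
Qed.

Lemma is_wirt_conj z : is_wirt (@conjc R) z 0.
Proof.
exists 1, (Complex 0 (-1)); split.
- split; under eq_fun do rewrite /conjc; case: z => x y /=.
    have := is_deriveD (is_derive_cst x (0 : R) (1 : R)) (is_derive_id (0 : R) (1 : R)).
    by rewrite add0r.
  by under eq_fun do rewrite addr0; exact: is_derive_cst.
- split; under eq_fun do rewrite /conjc; case: z => x y /=.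
    by under eq_fun do rewrite addr0; exact: is_derive_cst.
  have := is_deriveN (is_deriveD (is_derive_cst y (0 : R) (1 : R)) (is_derive_id (0 : R) (1 : R))).
  by rewrite add0r.
- by apply: complex_ext => /=; ring.
Qed.

(** Since |z|^2 is z times conj z and d/dz treats conj z as a constant, the exponent contributes -
    pi conj z. *)
Lemma is_wirt_gauss z : is_wirt (fun w => Complex (expR (- pi * nrm w ^+ 2)) 0) z
  (- Complex pi 0 * conjc z * Complex (expR (- pi * nrm z ^+ 2)) 0).
Proof.
case: z => x y; set E := expR _.
(* One coordinate moves while the square of the other is frozen in [k]; this serves both partial
   derivatives. *)
have dq (c k : R) : is_derive (0 : R) (1 : R)
    (fun t => expR (- pi * ((c + t) ^+ 2 + k))) (- pi * (2 * c) * expR (- pi * (c ^+ 2 + k))).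
  have di : is_derive (0 : R) (1 : R) (fun t => c + t) (1 : R).
    have := is_deriveD (is_derive_cst c (0 : R) (1 : R)) (is_derive_id (0 : R) (1 : R)).
    by rewrite add0r.
  have dsq : is_derive (0 : R) (1 : R) (fun t => (c + t) ^+ 2) (2 * c).
    under eq_fun do rewrite expr2.
    by apply: (is_deriveM_eq di di); rewrite addr0; ring.
  have dk : is_derive (0 : R) (1 : R) (fun t => (c + t) ^+ 2 + k) (2 * c).
    by have := is_deriveD dsq (is_derive_cst k (0 : R) (1 : R)); rewrite addr0.
  have dp : is_derive (0 : R) (1 : R) (fun t => - pi * ((c + t) ^+ 2 + k)) (- pi * (2 * c)).
    apply: (is_deriveM_eq (is_derive_cst (- pi) (0 : R) (1 : R)) dk).
    by rewrite mul0r add0r.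
  have := @is_derive1_comp R expR _ _ _ _ (is_derive_expR _) dp.
  by rewrite /= addr0 mulrC.
exists (Complex (- pi * (2 * x) * E) 0), (Complex (- pi * (2 * y) * E) 0); split.
- split; last exact: is_derive_cst.
  rewrite [X in is_derive _ _ X](_ : _ = fun t => expR (- pi * ((x + t) ^+ 2 + y ^+ 2))).
    by rewrite /E nrm_sqr; exact: dq.
  by apply/funext => t; rewrite /= nrm_sqr /= addr0.
- split; last exact: is_derive_cst.
  rewrite [X in is_derive _ _ X](_ : _ = fun t => expR (- pi * ((y + t) ^+ 2 + x ^+ 2))).
    by rewrite /E nrm_sqr addrC; exact: dq.
  by apply/funext => t; rewrite /= nrm_sqr /= addr0 addrC.
- by apply: complex_ext; rewrite /= ?(mulr0, mul0r, subr0, addr0, add0r, oppr0); field.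
Qed.

(** The direction [c] is free so that 1 and i give the two partial derivatives, and [c] equal to an
    endpoint gives the segment from 0 in [polylim_mvt]. *)
Lemma cder_path f z l c t : cder f (z + c * Complex t 0) l ->
  cpath_deriv (fun s => f (z + c * Complex s 0)) t (l * c).
Proof.
move=> [C [d [d0 H]]].
have c0 : 0 < nrm c + 1 by rewrite ltr_wpDl ?nrm_ge0.
have step (h : R) : `|h| < d / (nrm c + 1) ->
    nrm (f (z + c * Complex (t + h) 0) - f (z + c * Complex t 0) - l * c * Complex h 0)
      <= `|C| * nrm c ^+ 2 * h ^+ 2.
  rewrite ltr_pdivlMr// => hd.
  have -> : z + c * Complex (t + h) 0 = z + c * Complex t 0 + c * Complex h 0.
    by apply: complex_ext; rewrite !(ReD, ImD, ReM, ImM) /=; ring.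
  rewrite -mulrA; apply: (le_trans (H _ _)).
    rewrite nrmM nrm_real mulrC; apply: le_lt_trans hd.
    by rewrite ler_wpM2l// lerDl.
  rewrite nrmM nrm_real exprMn real_normK ?num_real// mulrA.
  by rewrite ler_wpM2r ?sqr_ge0// ler_wpM2r ?sqr_ge0 ?exprn_ge0 ?nrm_ge0// ler_norm.
split.
- apply: (@is_derive_quad R _ _ _ (`|C| * nrm c ^+ 2) (d / (nrm c + 1))).
    exact: divr_gt0.
  move=> h /step; apply: le_trans; apply: le_trans (nrm_Re _).
  by rewrite !(ReD, ReN, ReM) /= mulr0 subr0.
- apply: (@is_derive_quad R _ _ _ (`|C| * nrm c ^+ 2) (d / (nrm c + 1))).
    exact: divr_gt0.
  move=> h /step; apply: le_trans; apply: le_trans (nrm_Im _).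
  by rewrite !(ImD, ImN, ImM, ReM) /= mulr0 add0r.
Qed.

Lemma cder_is_wirt f z l : cder f z l -> is_wirt f z l.
Proof.
move=> fl; exists (l * 1), (l * Complex 0 1); split.
- have /(_ 1 0) := @cder_path f z l; rewrite mul1r addr0 => /(_ fl).
  by under eq_fun do rewrite mul1r.
- have /(_ (Complex 0 1) 0) := @cder_path f z l; rewrite mulr0 addr0 => /(_ fl).
  rewrite (_ : (fun s => _) = (fun t => f (z + Complex 0 t)))//.
  apply/funext => t; congr (f (_ + _)); apply: complex_ext => /=; ring.
- by case: l {fl} => a b; apply: complex_ext => /=; field.
Qed.

Lemma cder_wirt f z l : cder f z l -> wirt f z = l.
Proof. by move=> /cder_is_wirt/is_wirtE. Qed.

Lemma cder_comp f g z l m : cder f (g z) l -> cder g z m ->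
  cder (fun w => f (g w)) z (l * m).
Proof.
move=> [C [d [d0 fl]]] [C' [d' [d'0 gm]]].
(* A local Lipschitz constant of [g] at [z]: |g(z+h) - g(z)| <= K |h| for |h| < d'. *)
pose K := nrm m + `|C'| * d' + 1.
have K0 : 0 < K by rewrite ltr_wpDl// addr_ge0 ?nrm_ge0// mulr_ge0// ltW.
exists (`|C| * K ^+ 2 + nrm l * `|C'|), (Num.min d' (d / K)).
split; first by rewrite lt_min d'0 divr_gt0.
move=> h; rewrite lt_min => /andP[hd' hdK].
have g1 : nrm (g (z + h) - g z - m * h) <= `|C'| * nrm h ^+ 2.
  by apply: (le_trans (gm _ hd')); rewrite ler_wpM2r ?exprn_ge0 ?nrm_ge0// ler_norm.
pose k := g (z + h) - g z.
have kK : nrm k <= K * nrm h.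
  apply: (le_trans (nrm_leB _ (m * h))); rewrite nrmM.
  have : `|C'| * nrm h ^+ 2 <= `|C'| * (d' * nrm h).
    by rewrite ler_wpM2l// expr2 ler_wpM2r ?nrm_ge0// ltW.
  have -> : K * nrm h = nrm m * nrm h + `|C'| * (d' * nrm h) + nrm h.
    by rewrite /K; ring.
  have := nrm_ge0 h; move: g1; rewrite -/k; lra.
have f1 : nrm (f (g z + k) - f (g z) - l * k) <= `|C| * (K * nrm h) ^+ 2.
  apply: (le_trans (fl _ _)).
    by apply: le_lt_trans kK _; rewrite mulrC -ltr_pdivlMr.
  apply: (@le_trans _ _ (`|C| * nrm k ^+ 2)).
    by rewrite ler_wpM2r ?exprn_ge0 ?nrm_ge0// ler_norm.
  by rewrite ler_wpM2l// lerXn2r ?nnegrE ?nrm_ge0 ?mulr_ge0 ?nrm_ge0// ltW.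
have -> : g (z + h) = g z + k by rewrite /k; ring.
have -> : f (g z + k) - f (g z) - l * m * h =
   (f (g z + k) - f (g z) - l * k) + l * (k - m * h) by ring.
apply: (le_trans (nrmD _ _)); rewrite mulrDl; apply: lerD.
  by rewrite -mulrA -exprMn.
by rewrite nrmM -mulrA ler_wpM2l ?nrm_ge0.
Qed.

Lemma cder_cexp z : cder (@cexp R) z (cexp z).
Proof.
exists (nrm (cexp z) * 8), 2^-1; split; first by rewrite invr_gt0.
move=> h h2; rewrite cexpD.
have -> : cexp z * cexp h - cexp z - cexp z * h = cexp z * (cexp h - 1 - h) by ring.
by rewrite nrmM -mulrA ler_wpM2l ?nrm_ge0// cexp_quad// ltW.
Qed.

Lemma cexpMn n z : cexp (n%:R * z) = cexp z ^+ n.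
Proof.
elim: n => [|n IH]; first by rewrite mul0r cexp0 expr0.
by rewrite -natr1 mulrDl mul1r cexpD IH exprSr.
Qed.

Lemma nrm_subX (a b : R[i]) (r : R) n : nrm a <= r -> nrm b <= r ->
  nrm (a ^+ n - b ^+ n) <= n%:R * r ^+ n.-1 * nrm (a - b).
Proof.
move=> ar br; have r0 : 0 <= r by apply: le_trans ar; exact: nrm_ge0.
rewrite subrXX nrmM mulrC ler_wpM2r ?nrm_ge0//.
apply: (le_trans (nrm_sum _ _ _)); rewrite mulr_natl -[X in _ *+ X]card_ord -sumr_const.
apply: ler_sum => i _; rewrite nrmM !nrmX.
have -> : r ^+ n.-1 = r ^+ (n.-1 - i) * r ^+ i.
  by rewrite -exprD; congr (_ ^+ _); have := ltn_ord i; lia.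
by apply: ler_pM; rewrite ?exprn_ge0 ?nrm_ge0//; apply: lerXn2r; rewrite ?nnegrE ?nrm_ge0.
Qed.

(* (1 + z/n)^n converges to exp z uniformly on discs. *)
Lemma polylim_cexp : polylim (@cexp R).
Proof.
move=> r e e0.
pose r' := `|r| + 1; have r'0 : 0 < r' by rewrite /r' ltr_wpDl.
(* Factoring a^n - b^n with a = exp(z/n), b = 1 + z/n gives an error of at most n exp(r') 8 (r'/n)^2
   = c/n. The choice of [n] below makes this at most [e] and also forces |z/n| <= 1/2, the range of
   [cexp_quad]. *)
pose c := expR r' * (8 * r' ^+ 2).
have c0 : 0 < c by rewrite /c mulr_gt0 ?expR_gt0// mulr_gt0// exprn_gt0.
have [N hN] := invS_small (divr_gt0 e0 c0).
pose n := (maxn N (Num.bound (2 * r'))).+1.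
have n0 : 0 < n%:R :> R by rewrite ltr0n.
exists ((1 + (n%:R^-1)%:P * 'X) ^+ n) => z zr.
have zr' : nrm z <= r' by rewrite /r'; have := ler_norm r; lra.
pose x := n%:R^-1 * z.
have -> : cexp z = cexp x ^+ n.
  by rewrite -cexpMn /x mulrA divff ?mul1r// pnatr_eq0.
have -> : ((1 + (n%:R^-1)%:P * 'X) ^+ n).[z] = (1 + x) ^+ n.
  by rewrite horner_exp !hornerE.
have xn : nrm x = nrm z / n%:R by rewrite /x nrmM nrmV nrm_nat mulrC.
have xr : nrm x <= r' / n%:R by rewrite xn ler_wpM2r// invr_ge0 ltW.
have x2 : nrm x <= 2^-1.
  apply: (le_trans xr); rewrite ler_pdivrMr// mulrC ler_pdivlMr// mulrC.
  apply: (le_trans (ltW (archi_boundP _))); first by rewrite mulr_ge0// ltW.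
  by rewrite ler_nat /n ltnW// ltnS leq_maxr.
have b1 : nrm (cexp x) <= expR (r' / n%:R).
  rewrite nrm_cexp ler_expR; apply: le_trans xr.
  by apply: le_trans (nrm_Re _); exact: ler_norm.
have b2 : nrm (1 + x) <= expR (r' / n%:R).
  apply: (le_trans (nrmD _ _)); rewrite nrm1; apply: le_trans (expR_ge1Dx _).
  by rewrite lerD2l.
apply: (le_trans (nrm_subX _ b1 b2)).
have h1 : expR (r' / n%:R) ^+ n.-1 <= expR r'.
  rewrite -expRM_natl ler_expR mulrCA ler_piMr ?(ltW r'0)//.
  by rewrite ler_pdivrMr// mul1r ler_nat leq_pred.
have h2 : nrm (cexp x - (1 + x)) <= 8 * (r' / n%:R) ^+ 2.
  rewrite opprD addrA; apply: (le_trans (cexp_quad x2)).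
  by rewrite ler_wpM2l// lerXn2r ?nnegrE ?nrm_ge0// divr_ge0// ltW.
apply: (@le_trans _ _ (n%:R * expR r' * (8 * (r' / n%:R) ^+ 2))).
  rewrite ler_pM ?nrm_ge0 ?mulr_ge0 ?exprn_ge0 ?expR_ge0//.
  by rewrite ler_wpM2l.
have -> : n%:R * expR r' * (8 * (r' / n%:R) ^+ 2) = c * n%:R^-1.
  by rewrite /c; field; rewrite gt_eqF.
by rewrite mulrC -ler_pdivlMr// hN// leq_maxl.
Qed.

Lemma polylim_wirt f : polylim f -> [/\ polylim (wirt f),
  forall z, cder f z (wirt f z) &
  forall z r M, 0 < r -> (forall w, nrm (w - z) <= r -> nrm (f w) <= M) ->
    nrm (wirt f z) <= M / r].
Proof.
move=> /polylim_deriv[f' [Ef' ff' fb]].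
have -> : wirt f = f' by apply/funext => z; exact: cder_wirt.
by split.
Qed.

Lemma polylim_entire f : polylim f -> entire f.
Proof.
move=> /polylim_wirt[_ fd _] z; exists (wirt f z) => e e0.
have [C [d [d0 H]]] := fd z.
have C0 : 0 < `|C| + 1 by rewrite ltr_wpDl.
exists (Num.min d (e / (`|C| + 1))); split; first by rewrite lt_min d0 divr_gt0.
move=> h h0; rewrite lt_min => /andP[hd he].
have -> : (f (z + h) - f z) / h - wirt f z = (f (z + h) - f z - wirt f z * h) / h.
  by field.
have hp : 0 < nrm h by rewrite nrm_gt0.
rewrite nrmM nrmV ltr_pdivrMr//; apply: (le_lt_trans (H _ hd)).
rewrite expr2 mulrA ltr_pM2r//; apply: (@le_lt_trans _ _ ((`|C| + 1) * nrm h)).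
  by rewrite ler_wpM2r ?nrm_ge0//; have := ler_norm C; lra.
by rewrite mulrC -ltr_pdivlMr.
Qed.

(** The factor 2 comes from applying the real mean value theorem to the real and imaginary parts
    separately along the segment from 0 to [z]. *)
Lemma polylim_mvt f (z : R[i]) M : polylim f ->
  (forall w, nrm w <= nrm z -> nrm (wirt f w) <= M) ->
  nrm (f z - f 0) <= 2 * (M * nrm z).
Proof.
move=> /polylim_wirt[_ fd _] fM.
have dd t := cder_path (fd (0 + z * Complex t 0)).
have bnd t : 0 <= t <= 1 -> nrm (wirt f (0 + z * Complex t 0) * z) <= M * nrm z.
  move=> /andP[t0 t1]; rewrite nrmM ler_wpM2r ?nrm_ge0// fM// add0r nrmM nrm_real.
  by rewrite ger0_norm// ler_piMr ?nrm_ge0.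
have z1 : z * Complex 1 0 = z by rewrite -[Complex 1 0]/(1 : R[i]) mulr1.
have z0 : z * Complex 0 0 = 0 by rewrite -[Complex 0 0]/(0 : R[i]) mulr0.
have h1 := mvt_bound (M := M * nrm z) (ler01 : (0 : R) <= 1) (fun t => (dd t).1)
  (fun t ht => le_trans (nrm_Re _) (bnd t ht)).
have h2 := mvt_bound (M := M * nrm z) (ler01 : (0 : R) <= 1) (fun t => (dd t).2)
  (fun t ht => le_trans (nrm_Im _) (bnd t ht)).
move: h1 h2; rewrite z1 z0 !add0r subr0 mulr1 => h1 h2.
apply: (le_trans (nrm_le_ReIm _)); rewrite !(ReD, ImD, ReN, ImN); lra.
Qed.

End Wirtinger.

(** * Weierstrass factors, and series over lattice boxes *)

Section WeierstrassFactor.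
Variable R : realType.
Implicit Types (z w u l : R[i]) (p : {poly R[i]}).

Lemma cder_horner p z : cder (horner p) z p^`().[z].
Proof.
have [M [M0 pM]] := poly_bounded p (nrm z + 1).
exists (2 * M), 2^-1; split=> // h h2.
have := @poly_taylor_bound R p z 1 M h ltr01; rewrite divr1; apply; last by lra.
move=> w wz; apply: pM; apply: (le_trans (nrm_leB _ z)); exact: lerD.
Qed.

(** The Weierstrass primary factor of genus two, in one variable so that a single estimate serves
    all lattice points. *)
Definition wker (u : R[i]) := (1 - u) * cexp (u + u ^+ 2 / 2%:R).

Lemma wfacE z l : wfac z l = wker (z / l).
Proof.
rewrite /wfac /wker; congr (_ * cexp (_ + _)).
by rewrite exprMn exprVn invfM mulrA mulrAC.
Qed.

Let pw : {poly R[i]} := 'X + 2%:R^-1 *: 'X^2.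

Let pwE u : pw.[u] = u + u ^+ 2 / 2%:R.
Proof. by rewrite /pw hornerD hornerZ hornerX hornerXn [_^-1 * _]mulrC. Qed.

Lemma polylim_wker : polylim wker.
Proof.
have -> : wker = fun u => (1 - 'X : {poly R[i]}).[u] * cexp pw.[u].
  by apply/funext => u; rewrite pwE !hornerE.
apply: polylimM; first exact: polylim_horner.
exact/polylim_comp/polylim_cexp.
Qed.

(** The exponent has derivative 1 + u, and - 1 + (1 - u)(1 + u) = - u^2. This double zero at 0 makes
    [wker u - 1] cubic in [u], which is what convergence of the lattice product requires. *)
Lemma wirt_wker u : wirt wker u = - u ^+ 2 * cexp (u + u ^+ 2 / 2%:R).
Proof.
apply: is_wirtE.
have -> : wker = fun u => (1 - 'X : {poly R[i]}).[u] * cexp pw.[u].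
  by apply/funext => v; rewrite pwE !hornerE.
have d1 := cder_is_wirt (cder_horner (1 - 'X) u).
have d2 := cder_is_wirt (cder_comp (cder_cexp pw.[u]) (cder_horner pw u)).
have e1 : ((1 - 'X : {poly R[i]})^`()).[u] = -1.
  by rewrite derivB derivC derivX sub0r hornerN hornerC.
have e2 : (pw^`()).[u] = 1 + u.
  rewrite /pw derivD derivX derivZ derivXn !hornerD hornerC hornerZ hornerMn hornerXn.
  by rewrite expr1 -[u *+ 2]mulr_natl mulrA mulVf ?mul1r// pnatr_eq0.
have := is_wirtM d1 d2; congr is_wirt.
have e0 : (1 - 'X : {poly R[i]}).[u] = 1 - u by rewrite !hornerE.
rewrite e0 e1 e2 pwE; ring.
Qed.

Lemma wker_bound (rho : R) u : nrm u <= rho ->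
  nrm (wker u - 1) <= 2 * expR (rho + rho ^+ 2) * nrm u ^+ 3.
Proof.
move=> ur; have r0 : 0 <= rho by apply: le_trans ur; exact: nrm_ge0.
have <- : wker 0 = 1 by rewrite /wker subr0 expr0n mul0r addr0 cexp0 mulr1.
have := @polylim_mvt R wker u (nrm u ^+ 2 * expR (rho + rho ^+ 2)) polylim_wker.
have -> : 2 * (nrm u ^+ 2 * expR (rho + rho ^+ 2) * nrm u) =
  2 * expR (rho + rho ^+ 2) * nrm u ^+ 3 by ring.
apply=> w wu; rewrite wirt_wker nrmM nrmN nrmX nrm_cexp.
apply: ler_pM; rewrite ?exprn_ge0 ?nrm_ge0 ?expR_ge0//.
  by apply: lerXn2r; rewrite ?nnegrE ?nrm_ge0.
rewrite ler_expR; apply: (le_trans (ler_norm _)); apply: (le_trans (nrm_Re _)).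
apply: (le_trans (nrmD _ _)); rewrite nrmM nrmX nrmV nrm_nat.
have wr := le_trans wu ur; apply: lerD => //.
have : nrm w ^+ 2 <= rho ^+ 2 by apply: lerXn2r; rewrite ?nnegrE ?nrm_ge0.
have := exprn_ge0 2 (nrm_ge0 w); lra.
Qed.

Lemma polylim_wfac l : polylim (fun z => wfac z l).
Proof.
have -> : (fun z => wfac z l) = fun z => wker (l^-1 *: 'X : {poly R[i]}).[z].
  by apply/funext => z; rewrite wfacE !hornerE mulrC.
exact/polylim_comp/polylim_wker.
Qed.

End WeierstrassFactor.

Section Boxes.
Implicit Types (N M : nat) (P : pred (int * int)).

(** The windows of [sumsq] and [prodsq_nz] become duplicate-free sequences of integers and pairs, so
    that nested boxes can be compared up to permutation instead of through shifted ordinals. *)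
Definition zrange N := [seq i%:Z - N%:Z | i <- iota 0 (2 * N).+1].
Definition box N := [seq (a, b) | a <- zrange N, b <- zrange N].

Lemma mem_zrange N (a : int) : (a \in zrange N) = (- N%:Z <= a <= N%:Z).
Proof.
apply/mapP/idP => [[k]|aN]; first by rewrite mem_iota => /andP[_ ?] ->; lia.
exists `|(a + N%:Z)%R|%N; last by lia.
by rewrite mem_iota; lia.
Qed.

Lemma zrange_uniq N : uniq (zrange N).
Proof. by rewrite map_inj_uniq ?iota_uniq// => i j /addIr[]. Qed.

Lemma box_uniq N : uniq (box N).
Proof. by apply: allpairs_uniq; rewrite ?zrange_uniq// => -[x y] [x' y'] _ _ [-> ->]. Qed.

Lemma mem_box N p : (p \in box N) = (p.1 \in zrange N) && (p.2 \in zrange N).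
Proof.
case: p => a b; apply/allpairsP/andP => [[[x y] [/= xN yN [-> ->]]]//|[aN bN]].
by exists (a, b).
Qed.

Lemma box_sub N M : (N <= M)%N -> {subset box N <= box M}.
Proof. by move=> NM p; rewrite !mem_box !mem_zrange; lia. Qed.

Lemma big_zrange (T : Type) (idx : T) (op : Monoid.law idx) N (F : int -> T) :
  \big[op/idx]_(i < (2 * N).+1) F (i%:Z - N%:Z) = \big[op/idx]_(a <- zrange N) F a.
Proof.
by rewrite big_map -[in RHS](subn0 (2 * N).+1) -/(index_iota 0 _) big_mkord.
Qed.

Lemma big_box (T : Type) (idx : T) (op : Monoid.com_law idx) N (F : int -> int -> T) :
  \big[op/idx]_(a <- zrange N) \big[op/idx]_(b <- zrange N) F a b =
  \big[op/idx]_(p <- box N) F p.1 p.2.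
Proof. by rewrite /box big_allpairs_dep. Qed.

Lemma big_box_split (T : Type) (idx : T) (op : Monoid.com_law idx) N M P
    (F : int * int -> T) : (N <= M)%N ->
  \big[op/idx]_(p <- box M | P p) F p =
  op (\big[op/idx]_(p <- box N | P p) F p)
     (\big[op/idx]_(p <- box M | P p && (p \notin box N)) F p).
Proof.
move=> NM; rewrite (bigID (mem (box N))) /=; congr (op _ _).
rewrite -[LHS]big_filter -[RHS]big_filter; apply: perm_big.
apply: uniq_perm; rewrite ?filter_uniq ?box_uniq// => p.
rewrite !mem_filter; case: (boolP (p \in box N)) => [pN|]; last by rewrite !andbF.
by rewrite (box_sub NM pN) !andbT.
Qed.

Lemma sumsqE (R : realType) N (g : int -> int -> R[i]) :
  sumsq N g = \sum_(p <- box N) g p.1 p.2.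
Proof.
rewrite -big_box /sumsq -big_zrange; apply: eq_bigr => i _.
by rewrite -[RHS]big_zrange.
Qed.

Lemma sum_box_real (R : realType) N (g : int -> int -> R) :
  \sum_(i < (2 * N).+1) \sum_(j < (2 * N).+1) g (i%:Z - N%:Z) (j%:Z - N%:Z)
   = \sum_(p <- box N) g p.1 p.2.
Proof.
rewrite -big_box -big_zrange; apply: eq_bigr => i _.
by rewrite -[RHS]big_zrange.
Qed.

Lemma prodsq_nzE (R : realType) N (g : int -> int -> R[i]) :
  prodsq_nz N g = \prod_(p <- box N | p != (0, 0)) g p.1 p.2.
Proof.
rewrite big_mkcond -(big_box _ N (fun a b => if (a, b) != (0, 0) then g a b else 1)).
rewrite /prodsq_nz -big_zrange; apply: eq_bigr => i _.
rewrite -[RHS]big_zrange big_mkcond; apply: eq_bigr => j _.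
by rewrite !xpair_eqE !subr_eq0.
Qed.

End Boxes.

Section BoxSeries.
Variable R : realType.
Implicit Types (b : int * int -> R) (f : int * int -> R[i] -> R[i]).

Definition bsummable b := (forall p, 0 <= b p) /\
  exists B, forall N, \sum_(p <- box N) b p <= B.

Lemma bsummableZ b k : 0 <= k -> bsummable b -> bsummable (fun p => k * b p).
Proof.
move=> k0 [b0 [B bB]]; split=> [p|]; first exact: mulr_ge0.
by exists (k * B) => N; rewrite -mulr_sumr ler_wpM2l.
Qed.

(** Box sums increase with the box and are bounded, so they converge; a tail is the difference of
    two of them. *)
Lemma bsummable_tail b (e : R) : bsummable b -> 0 < e -> exists N0, forall N M,
  (N0 <= N)%N -> (N <= M)%N -> \sum_(p <- box M | p \notin box N) b p <= e.
Proof.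
move=> [b0 [B bB]] e0; pose S N := \sum_(p <- box N) b p.
have SE N M : (N <= M)%N -> S M = S N + \sum_(p <- box M | p \notin box N) b p.
  by move=> NM; rewrite /S (big_box_split _ xpredT _ NM).
have Sm : {homo S : n m / (n <= m)%N >-> n <= m}.
  by move=> N M NM; rewrite (SE _ _ NM) lerDl sumr_ge0.
have : cvgn S.
  by apply: nondecreasing_is_cvgn => //; exists B => _ [N _ <-]; exact: bB.
move=> /cvg_ex[l /cvgrPdist_le Sl].
have [|N0 _ hN] := Sl (e / 2); first by lra.
exists N0 => N M N0N NM; have := SE _ _ NM.
have := hN _ N0N; have /= := hN _ (leq_trans N0N NM).
by rewrite !ler_norml => /andP[? ?] /andP[? ?]; lra.
Qed.

Lemma lucauchy_le (fs : nat -> R[i] -> R[i]) :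
  (forall r e, 0 < e -> exists N, forall k l, (N <= k)%N -> (k <= l)%N ->
    forall z, nrm z <= r -> nrm (fs l z - fs k z) <= e) ->
  exists g : R[i] -> R[i], lucvg fs g.
Proof.
move=> fC; apply: lucauchy => r e /(fC r)[N hN]; exists N => k l Nk Nl z zr.
by have [kl|/ltnW lk] := leqP k l; [rewrite nrmBC|]; exact: hN.
Qed.

(** The Weierstrass M-test, with a majorant allowed to depend on the radius of the disc. *)
Lemma box_series_lucvg f :
  (forall r, exists2 b, bsummable b & forall p z, nrm z <= r -> nrm (f p z) <= b p) ->
  exists F, lucvg (fun N z => \sum_(p <- box N) f p z) F.
Proof.
move=> fb; apply: lucauchy_le => r e e0; have [b bs bf] := fb r.
have [N0 hN] := bsummable_tail bs e0; exists N0 => k l Nk kl z zr.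
rewrite (big_box_split _ xpredT _ kl) /= addrAC subrr add0r.
apply: (le_trans (nrm_sum _ _ _)); apply: le_trans (hN _ _ Nk kl).
by apply: ler_sum => p _; exact: bf.
Qed.

(** Induction with Fx - 1 = (F - 1)(x - 1) + (F - 1) + (x - 1) and 1 + a <= exp(a). Avoiding
    logarithms permits factors that vanish, as they do at lattice points. *)
Lemma nrm_prodB1 (I : Type) (s : seq I) (P : pred I) (F : I -> R[i]) :
  nrm (\prod_(i <- s | P i) F i - 1) <= expR (\sum_(i <- s | P i) nrm (F i - 1)) - 1.
Proof.
elim: s => [|i s IH]; first by rewrite !big_nil subrr nrm0 expR0 subrr.
rewrite !big_cons; case: (P i) => //.
set x := \prod_(_ <- _ | _) _ in IH *; set t := \sum_(_ <- _ | _) _ in IH *.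
have -> : F i * x - 1 = (F i - 1) * (x - 1) + (F i - 1) + (x - 1) by ring.
rewrite expRD; set a := nrm (F i - 1).
have h1 := nrmD ((F i - 1) * (x - 1) + (F i - 1)) (x - 1).
have h2 := nrmD ((F i - 1) * (x - 1)) (F i - 1).
have h3 : a * nrm (x - 1) <= a * (expR t - 1) by rewrite ler_wpM2l ?nrm_ge0.
have h4 : (1 + a) * expR t <= expR a * expR t.
  by rewrite ler_wpM2r ?expR_ge0// expR_ge1Dx.
by move: h1 h2 h3 h4; rewrite nrmM -/a; lra.
Qed.

(** Partial products stay below exp(B), and enlarging the box multiplies them by a number within 2t
    of 1, where t is at most a tail of the majorant. *)
Lemma box_product_lucvg f (P : pred (int * int)) :
  (forall r, exists2 b, bsummable b &
     forall p z, P p -> nrm z <= r -> nrm (f p z - 1) <= b p) ->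
  exists F, lucvg (fun N z => \prod_(p <- box N | P p) f p z) F.
Proof.
move=> fb; apply: lucauchy_le => r e e0; have [b bs bf] := fb r.
have [b0 [B bB]] := bs.
(* The bound t <= 1/2 gives exp(t) - 1 <= t + 2t^2 <= 2t; the second bound makes exp(B) times 2t at
   most [e]. *)
have c0 : 0 < Num.min 2^-1 (e / (2 * expR B)).
  by rewrite lt_min invr_gt0 ltr0n /= divr_gt0// mulr_gt0// expR_gt0.
have [N0 hN] := bsummable_tail bs c0; exists N0 => k l Nk kl z zr.
rewrite (big_box_split _ P _ kl) /=.
set x := \prod_(_ <- box k | _) _; set y := \prod_(_ <- box l | _) _.
have -> : x * y - x = x * (y - 1) by ring.
have bP (s : seq (int * int)) (Q : pred (int * int)) : \sum_(p <- s | P p && Q p) nrm (f p z - 1)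
    <= \sum_(p <- s | Q p) b p.
  rewrite [leRHS](bigID P) /= -[leLHS]addr0 lerD// ?sumr_ge0//.
  rewrite [leRHS](eq_bigl (fun p => P p && Q p)); last by move=> p; rewrite andbC.
  by apply: ler_sum => p /andP[Pp _]; exact: bf.
have xB : nrm x <= expR B.
  have := nrm_prodB1 (box k) P (fun p => f p z); rewrite -/x => h.
  have := nrm_leB x 1; rewrite nrm1.
  have : expR (\sum_(p <- box k | P p) nrm (f p z - 1)) <= expR B.
    rewrite ler_expR; apply: le_trans (bB k).
    have := bP (box k) xpredT; rewrite (eq_bigl P)// => p; by rewrite andbT.
  by lra.
set t := \sum_(p <- box l | P p && (p \notin box k)) nrm (f p z - 1).
have ty : nrm (y - 1) <= expR t - 1 := nrm_prodB1 _ _ _.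
have t0 : 0 <= t by rewrite sumr_ge0// => p _; exact: nrm_ge0.
have : t <= Num.min 2^-1 (e / (2 * expR B)).
  by apply: le_trans (hN _ _ Nk kl); exact: bP.
rewrite le_min => /andP[t2 te].
have : nrm (y - 1) <= 2 * t.
  apply: (le_trans ty).
  have := expR_quad (x := t); rewrite ger0_norm// => /(_ t2).
  by rewrite ler_norml => /andP[_]; nra.
move=> yt; rewrite nrmM.
apply: (@le_trans _ _ (expR B * (2 * (e / (2 * expR B))))).
  apply: ler_pM; rewrite ?nrm_ge0//; apply: (le_trans yt); lra.
rewrite le_eqVlt; apply/orP; left; apply/eqP; field; by rewrite gt_eqF ?expR_gt0.
Qed.

End BoxSeries.

(** * Lattice sums and the sigma function *)

Section LatticeSums.
Variable R : realType.
Implicit Types (x y t A : R).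

(** The function x / (A + |x|) has derivative A / (A + |x|)^2, so this is a discrete integral
    comparison; the factor 2 absorbs the change of A + |x| over a unit step, as A >= 1. The cases
    follow the signs of x and x + 1. *)
Lemma telescope_step A x : 1 <= A ->
  ((A + `|x|) ^+ 2)^-1 <= 2 / A * ((x + 1) / (A + `|x + 1|) - x / (A + `|x|)).
Proof.
move=> A1.
have gen a b c : 0 < a -> 0 < b -> A / 2 * b <= c * a ->
    (a ^+ 2)^-1 <= 2 / A * (c / (a * b)).
  move=> a0 b0 H.
  have -> : 2 / A * (c / (a * b)) = (c * a) / (A / 2 * b) * (a ^+ 2)^-1.
    by field; rewrite !gt_eqF//; lra.
  have A2b : 0 < A / 2 * b by rewrite mulr_gt0// divr_gt0//; lra.
  rewrite ler_peMl ?invr_ge0 ?exprn_ge0 ?(ltW a0)//.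
  by rewrite ler_pdivlMr// mul1r.
have [x0|x0] := leP 0 x.
  rewrite !ger0_norm//; last by lra.
  have -> : (x + 1) / (A + (x + 1)) - x / (A + x) = A / ((A + x) * (A + x + 1)).
    by field; rewrite !gt_eqF//; lra.
  apply: gen; nra.
have [x1|x1] := leP 0 (x + 1).
  rewrite (ltr0_norm x0) (ger0_norm x1).
  have -> : (x + 1) / (A + (x + 1)) - x / (A - x) =
      (A - 2 * x * (x + 1)) / ((A - x) * (A + x + 1)).
    by field; rewrite !gt_eqF//; lra.
  apply: gen; [lra|lra|].
  have h1 : A / 2 * (A + x + 1) <= A * (A - x) by nra.
  have h2 : 0 <= - x * (x + 1) * (A - x).
    by apply: mulr_ge0; [apply: mulr_ge0 => //|]; lra.
  have -> : (A - 2 * x * (x + 1)) * (A - x) =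
    A * (A - x) + 2 * (- x * (x + 1) * (A - x)) by ring.
  lra.
rewrite (ltr0_norm x0) (ltr0_norm x1).
have -> : (x + 1) / (A - (x + 1)) - x / (A - x) = A / ((A - x) * (A - x - 1)).
  by field; rewrite !gt_eqF//; lra.
apply: gen; nra.
Qed.

Lemma zrange_sum A t N : 1 <= A ->
  \sum_(a <- zrange N) ((A + `|a%:~R - t|) ^+ 2)^-1 <= 4 / A.
Proof.
(* The telescoping primitive lies in [-1, 1], so the sum is at most (2/A) times 2, whatever [t] and
   [N] are. *)
move=> A1; pose u (k : nat) := (k%:R - N%:R - t) / (A + `|k%:R - N%:R - t|).
have u1 k : `|u k| <= 1.
  rewrite /u; set X := k%:R - _ - _; have X0 : 0 < A + `|X| by rewrite ltr_pwDl//; lra.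
  by rewrite normrM normfV (gtr0_norm X0) ler_pdivrMr// mul1r; lra.
rewrite -(big_zrange _ N (fun a => ((A + `|a%:~R - t|) ^+ 2)^-1)).
apply: (@le_trans _ _ (\sum_(i < (2 * N).+1) 2 / A * (u i.+1 - u i))).
  apply: ler_sum => i _.
  have -> : ((i : nat)%:Z - N%:Z)%:~R = (i : nat)%:R - N%:R :> R by rewrite intrB.
  apply: (le_trans (telescope_step _ A1)).
  rewrite /u; have -> // : (nat_of_ord i).+1%:R - N%:R - t = i%:R - N%:R - t + 1.
  by rewrite -natr1; ring.
rewrite -mulr_sumr -(big_mkord xpredT (fun i => u i.+1 - u i)) telescope_sumr//.
have -> : 4 / A = 2 / A * 2 by field; rewrite gt_eqF//; lra.
rewrite ler_wpM2l// ?divr_ge0//; first by lra.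
by have := u1 (2 * N).+1; have := u1 0%N; rewrite !ler_norml => /andP[? ?] /andP[? ?]; lra.
Qed.

Lemma box_prod_sum (F G : int -> R) N :
  \sum_(p <- box N) F p.1 * G p.2 =
  (\sum_(a <- zrange N) F a) * (\sum_(b <- zrange N) G b).
Proof.
rewrite -(big_box _ N (fun a b => F a * G b)) mulr_suml.
by apply: eq_bigr => a _; rewrite mulr_sumr.
Qed.

Lemma box_sum_le x y N :
  \sum_(p <- box N) (((1 + `|p.1%:~R - x|) ^+ 2)^-1 * ((1 + `|p.2%:~R - y|) ^+ 2)^-1)
    <= 16 :> R.
Proof.
rewrite (box_prod_sum (fun a => ((1 + `|a%:~R - x|) ^+ 2)^-1)
  (fun b => ((1 + `|b%:~R - y|) ^+ 2)^-1)).
have h t := @zrange_sum 1 t N (lexx 1); rewrite divr1 in h.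
rewrite (_ : 16 = 4 * 4 :> R); last by lra.
by apply: ler_pM => //; apply: sumr_ge0 => a _; rewrite invr_ge0 exprn_ge0// addr_ge0.
Qed.

(** With A = 1 + |a| the cube is at least A (A + |b|)^2, so summing over b leaves 4 / A^2, and a
    second use of [zrange_sum] gives 16. The explicit dependence on [A] in that lemma exists for
    this. *)
Lemma bsummable_cube :
  bsummable (fun p : int * int => ((1 + `|p.1%:~R : R| + `|p.2%:~R|) ^+ 3)^-1).
Proof.
split=> [p|]; first by rewrite invr_ge0 exprn_ge0// !addr_ge0.
exists 16 => N.
rewrite -(big_box _ N (fun a b => ((1 + `|a%:~R : R| + `|b%:~R|) ^+ 3)^-1)).
apply: (@le_trans _ _ (\sum_(a <- zrange N) 4 * ((1 + `|a%:~R - 0 : R|) ^+ 2)^-1)).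
  apply: ler_sum => a _; rewrite subr0; set A : R := 1 + _.
  have A1 : 1 <= A by rewrite lerDl.
  have A0 : 0 < A by lra.
  apply: (@le_trans _ _ (\sum_(b <- zrange N) A^-1 * ((A + `|b%:~R - 0|) ^+ 2)^-1)).
    apply: ler_sum => b _; rewrite subr0 -invfM lef_pV2 ?posrE//.
    - by rewrite [leRHS]exprS ler_wpM2r ?exprn_ge0 ?lerDl// addr_ge0// ltW.
    - by rewrite exprn_gt0// ltr_wpDr.
    - by rewrite mulr_gt0// exprn_gt0// ltr_wpDr.
  rewrite -mulr_sumr; apply: (le_trans (ler_wpM2l _ (zrange_sum 0 N A1))).
    by rewrite invr_ge0 ltW.
  by rewrite le_eqVlt; apply/orP; left; apply/eqP; field; rewrite gt_eqF.
rewrite -mulr_sumr; have := @zrange_sum 1 0 N (lexx 1); rewrite divr1; lra.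
Qed.

(** From y^4 / 4! <= exp(y) at y = 1 + Lr, then completing the square in - d r^2 + L r. The fourth
    power provides one summable square for each of the two lattice coordinates. *)
Lemma gauss_decay (d L : R) : 0 < d -> 0 <= L -> exists2 C, 0 < C &
  forall r, 0 <= r -> expR (- d * r ^+ 2) <= C * ((1 + L * r) ^+ 4)^-1.
Proof.
move=> d0 L0; exists (24 * expR (1 + L ^+ 2 / (4 * d))) => [|r r0].
  by rewrite mulr_gt0// expR_gt0.
have y0 : 0 < 1 + L * r by rewrite ltr_pwDl// mulr_ge0.
rewrite ler_pdivlMr ?exprn_gt0//.
have h1 : (1 + L * r) ^+ 4 <= 24 * expR (1 + L * r).
  have e4 : (4`! = 24)%N by [].
  have := expR_ge1Dxn 3 (ltW y0); rewrite e4.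
  have := exprn_ge0 4 (ltW y0); move: (_ ^+ 4) (expR _) => a b a0 h.
  have : a / 24 <= b by lra.
  lra.
apply: (@le_trans _ _ (expR (- d * r ^+ 2) * (24 * expR (1 + L * r)))).
  by rewrite ler_wpM2l// expR_ge0.
rewrite mulrCA -expRD ler_wpM2l// ler_expR.
have : 0 <= d * (r - L / (2 * d)) ^+ 2 by rewrite mulr_ge0 ?sqr_ge0// ltW.
have -> : d * (r - L / (2 * d)) ^+ 2 = d * r ^+ 2 - L * r + L ^+ 2 / (4 * d).
  by field; rewrite gt_eqF.
lra.
Qed.

End LatticeSums.

Section Lattice.
Variables (R : realType) (w1 w2 : R[i]).
Hypothesis area_gt0 : 0 < area w1 w2.
Implicit Types (u v z : R[i]) (p : int * int).

(** By Cramer's rule [c1] and [c2] are the real coordinates in the basis [w1], [w2], and [L] bounds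
    both by L |z|. This reduces lattice estimates to sums over integers. *)
Let cross u v := complex.Re u * complex.Im v - complex.Im u * complex.Re v.
Let D := cross w1 w2.
Let c1 z := cross z w2 / D.
Let c2 z := cross w1 z / D.
Local Notation lat p := (latpt w1 w2 p.1 p.2).
Let L := (nrm w1 + nrm w2) / area w1 w2.

Let D0 : D != 0. Proof. by rewrite -normr_gt0. Qed.

Let cross_le u v : `|cross u v| <= nrm u * nrm v.
Proof.
rewrite -(nrm_conj u) -nrmM; have := nrm_Im (conjc u * v).
by rewrite ImM; case: u => a b; case: v => c d; rewrite /cross /= mulNr.
Qed.

Lemma intC (m : int) : (m%:~R : R[i]) = Complex m%:~R 0.
Proof. by rewrite -[RHS]/(real_complex R m%:~R) rmorph_int. Qed.

Let c1B z p : c1 (z - lat p) = c1 z - p.1%:~R.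
Proof.
have e : cross (z - lat p) w2 = cross z w2 - p.1%:~R * D.
  rewrite /D /cross /latpt !intC !(ReD, ImD, ReN, ImN, ReM, ImM) /=; ring.
by rewrite /c1 e mulrBl mulfK.
Qed.

Let c2B z p : c2 (z - lat p) = c2 z - p.2%:~R.
Proof.
have e : cross w1 (z - lat p) = cross w1 z - p.2%:~R * D.
  rewrite /D /cross /latpt !intC !(ReD, ImD, ReN, ImN, ReM, ImM) /=; ring.
by rewrite /c2 e mulrBl mulfK.
Qed.

Let L0 : 0 < L.
Proof.
rewrite divr_gt0// lt_def addr_ge0 ?nrm_ge0// andbT.
rewrite paddr_eq0 ?nrm_ge0// nrm_eq0; apply/negP => /andP[/eqP w10 _].
by move: D0; rewrite /D /cross w10 /= !mul0r subr0 eqxx.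
Qed.

Let c1_le z : `|c1 z| <= L * nrm z.
Proof.
rewrite normrM normfV -/(area w1 w2) /L mulrAC ler_pM2r ?invr_gt0//.
apply: (le_trans (cross_le _ _)).
by rewrite mulrC ler_wpM2r ?nrm_ge0// lerDr nrm_ge0.
Qed.

Let c2_le z : `|c2 z| <= L * nrm z.
Proof.
rewrite normrM normfV -/(area w1 w2) /L mulrAC ler_pM2r ?invr_gt0//.
apply: (le_trans (cross_le _ _)).
by rewrite ler_wpM2r ?nrm_ge0// lerDl nrm_ge0.
Qed.

(** The Gaussian is dominated by a product of inverse squares centred at the coordinates of [z].
    Uniformity in [z] is essential for the Cauchy-Schwarz step of [fock_bound]. *)
Lemma latpt_gauss_sum (d : R) : 0 < d -> exists C, forall z N,
  \sum_(p <- box N) expR (- d * nrm (z - lat p) ^+ 2) <= C.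
Proof.
move=> d0; have [C C0 hC] := gauss_decay d0 (ltW L0).
exists (C * 16) => z N.
apply: le_trans (ler_wpM2l (ltW C0) (box_sum_le (c1 z) (c2 z) N)).
rewrite mulr_sumr; apply: ler_sum => p _.
apply: (le_trans (hC _ (nrm_ge0 _))); rewrite ler_wpM2l ?(ltW C0)//.
rewrite -invfM lef_pV2 ?posrE.
- rewrite (_ : 4%N = (2 + 2)%N)// exprD.
  have h1 : 1 + `|p.1%:~R - c1 z| <= 1 + L * nrm (z - lat p).
    by rewrite lerD2l distrC -c1B.
  have h2 : 1 + `|p.2%:~R - c2 z| <= 1 + L * nrm (z - lat p).
    by rewrite lerD2l distrC -c2B.
  have n0 : 0 <= 1 + L * nrm (z - lat p).
    by rewrite addr_ge0// mulr_ge0 ?nrm_ge0 ?(ltW L0).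
  apply: ler_pM; [exact/exprn_ge0/addr_ge0|exact/exprn_ge0/addr_ge0| |].
    by apply: lerXn2r h1; rewrite ?nnegrE// addr_ge0.
  by apply: lerXn2r h2; rewrite ?nnegrE// addr_ge0.
- by rewrite exprn_gt0// ltr_pwDl// mulr_ge0 ?nrm_ge0// ltW.
- by rewrite mulr_gt0// exprn_gt0// ltr_pwDl.
Qed.

(** A nonzero integer pair satisfies 1 <= |m1| + |m2|, so the left side is at most twice that sum,
    and each coordinate is at most L |lambda|. *)
Lemma latpt_ge p : p != (0, 0) ->
  1 + `|p.1%:~R| + `|p.2%:~R| <= 4 * L * nrm (lat p).
Proof.
move=> p0.
have c10 : c1 0 = 0 by rewrite /c1 /cross /= !mul0r subr0 mul0r.
have c20 : c2 0 = 0 by rewrite /c2 /cross /= !mulr0 subr0 mul0r.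
have h1 : `|p.1%:~R| <= L * nrm (lat p).
  by have := c1_le (0 - lat p); rewrite c1B c10 !sub0r normrN nrmN.
have h2 : `|p.2%:~R| <= L * nrm (lat p).
  by have := c2_le (0 - lat p); rewrite c2B c20 !sub0r normrN nrmN.
have h3 : 1 <= `|p.1%:~R : R| + `|p.2%:~R|.
  rewrite -!intr_norm -intrD (_ : 1 = 1%:~R)// ler_int.
  case: p p0 {h1 h2} => a b /=; rewrite xpair_eqE => p0; lia.
lra.
Qed.

Lemma latpt_eq0 p : lat p = 0 -> p = (0, 0).
Proof.
move=> l0; apply/eqP; apply/negP => /negP/latpt_ge; rewrite l0 nrm0 mulr0.
by apply/negP; rewrite -ltNge -addrA ltr_pwDl// addr_ge0.
Qed.

Lemma latptB p p' : lat p - lat p' = latpt w1 w2 (p.1 - p'.1) (p.2 - p'.2).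
Proof. by rewrite /latpt !intrB; ring. Qed.

Section Sigma.
Variable q : R[i] -> R[i].
Hypothesis hq : forall z : R[i],
  ccvg (fun N => prodsq_nz N (fun m1 m2 => wfac z (latpt w1 w2 m1 m2))) (q z).

(** The hypothesis on [q] is a pointwise limit. The same partial products are shown to converge
    locally uniformly to some [F], and uniqueness of limits identifies [F] with [q]. *)
Lemma sigma_polylim : polylim q.
Proof.
have [|F FE] := @box_product_lucvg R (fun p z => wfac z (lat p)) (fun p => p != (0, 0)).
  (* [latpt_ge] gives |z/lambda| <= rho / (1 + |m1| + |m2|), which is also at most [rho]; the cubic
     bound of [wker_bound] then yields the summable majorant. *)
  move=> r; pose rho := `|r| * (4 * L).
  have rho0 : 0 <= rho by rewrite /rho mulr_ge0// mulr_ge0// ltW.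
  have K1 : 0 <= 2 * expR (rho + rho ^+ 2) by rewrite mulr_ge0// expR_ge0.
  have K0 : 0 <= 2 * expR (rho + rho ^+ 2) * rho ^+ 3.
    by apply: mulr_ge0 => //; exact: exprn_ge0.
  exists (fun p => 2 * expR (rho + rho ^+ 2) * rho ^+ 3 *
     ((1 + `|p.1%:~R : R| + `|p.2%:~R|) ^+ 3)^-1).
    exact: bsummableZ K0 (bsummable_cube R).
  move=> p z p0 zr; rewrite wfacE.
  have y1 : 1 <= 1 + `|p.1%:~R : R| + `|p.2%:~R| by rewrite -addrA lerDl addr_ge0.
  have yl := latpt_ge p0; set y := 1 + _ + _ in y1 yl *.
  have y0 : 0 < y by lra.
  have l0 : 0 < nrm (lat p).
    by rewrite nrm_gt0; apply: contraNneq p0 => /latpt_eq0 ->.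
  have u1 : nrm (z / lat p) <= rho / y.
    rewrite nrmM nrmV ler_pdivrMr// /rho mulrAC ler_pdivlMr// -mulrA.
    apply: ler_pM; rewrite ?nrm_ge0 ?(ltW y0)//.
    exact: le_trans zr (ler_norm r).
  have u2 : nrm (z / lat p) <= rho.
    by apply: (le_trans u1); rewrite ler_pdivrMr// ler_peMr.
  apply: (le_trans (wker_bound u2)).
  rewrite -[leRHS]mulrA; apply: ler_wpM2l => //; rewrite -exprVn -exprMn.
  by apply: lerXn2r; rewrite ?nnegrE ?nrm_ge0// divr_ge0// ltW.
have -> : q = F.
  apply/funext => z; have := hq z.
  under eq_fun do rewrite prodsq_nzE.
  by move=> qz; apply: (ccvg_uniq qz); exact: lucvg_ccvg z FE.
apply: polylim_lucvg FE => N; apply: polylim_prod => p; exact: polylim_wfac.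
Qed.

Lemma sigma0 : q 0 = 1.
Proof.
apply: (ccvg_uniq (hq 0)) => e e0; exists 0%N => k _; rewrite prodsq_nzE.
rewrite big1 ?subrr ?nrm0// => p _.
by rewrite wfacE mul0r /wker subr0 expr0n mul0r addr0 cexp0 mulr1.
Qed.

Lemma sigma_latpt p : p != (0, 0) -> q (lat p) = 0.
Proof.
move=> p0; apply: (ccvg_uniq (hq _)) => e e0.
exists (maxn `|p.1|%N `|p.2|%N) => k; rewrite geq_max => /andP[k1 k2].
have l0 : lat p != 0 by apply: contraNneq p0 => /latpt_eq0 ->.
rewrite prodsq_nzE (big_rem p) /=; last first.
  by rewrite mem_box !mem_zrange; move: k1 k2; case: (p) => a b /=; lia.
by rewrite p0 wfacE divff// /wker subrr !mul0r subrr nrm0.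
Qed.

End Sigma.
End Lattice.

(** * The raising operator *)

#[local] Arguments conjc : simpl never.

Section Raising.
Variable R : realType.
Implicit Types (z w u c l : R[i]) (f g Q h : R[i] -> R[i]) (al be : R).

Local Notation gauss w := (Complex (expR (- pi * nrm w ^+ 2)) 0).

Lemma polylim_is_wirt f z : polylim f -> is_wirt f z (wirt f z).
Proof. by move=> /polylim_wirt[_ fd _]; exact: cder_is_wirt. Qed.

Lemma polylim_wirtP f : polylim f -> polylim (wirt f).
Proof. by case/polylim_wirt. Qed.

Lemma wirtD f g : polylim f -> polylim g ->
  wirt (fun z => f z + g z) = fun z => wirt f z + wirt g z.
Proof.
move=> Ef Eg; apply/funext => z; apply: is_wirtE; apply: is_wirtD;
  exact: polylim_is_wirt.
Qed.

Lemma polylimZ c f : polylim f -> polylim (fun z => c * f z).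
Proof. by move=> Ef; apply: polylimM => //; exact: polylim_cst. Qed.

Lemma wirtZ c f : polylim f -> wirt (fun z => c * f z) = fun z => c * wirt f z.
Proof.
move=> Ef; apply/funext => z; apply: is_wirtE.
by have := is_wirtM (is_wirt_cst c z) (polylim_is_wirt z Ef); rewrite mul0r add0r.
Qed.

Lemma wirtM f g : polylim f -> polylim g ->
  wirt (fun z => f z * g z) = fun z => wirt f z * g z + f z * wirt g z.
Proof.
move=> Ef Eg; apply/funext => z; apply: is_wirtE; apply: is_wirtM;
  exact: polylim_is_wirt.
Qed.

(* [raisen n f z] is [exp(pi |z|^2) (d/dz)^n (exp(- pi |z|^2) f(z))] for entire
   [f]: each step is [d/dz - pi * conj z], and [d/dz] commutes with [conj z]. *)
Fixpoint raisen n f z : R[i] :=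
  if n is m.+1 then raisen m (wirt f) z - Complex pi 0 * conjc z * raisen m f z
  else f z.

(** As d/dz annihilates conj z, differentiation passes through every factor conj z and reaches only
    [f]. *)
Lemma is_wirt_raisen n f z : polylim f ->
  is_wirt (raisen n f) z (raisen n (wirt f) z).
Proof.
elim: n f z => [|n IH] f z Ef /=; first exact: polylim_is_wirt.
have Ef' := polylim_wirtP Ef.
have h1 := is_wirtM (is_wirt_cst (- Complex pi 0) z) (is_wirt_conj z).
have h2 := is_wirtD (IH _ z Ef') (is_wirtM h1 (IH _ z Ef)).
have e1 : (fun w => raisen n (wirt f) w - Complex pi 0 * conjc w * raisen n f w) =
  (fun w => raisen n (wirt f) w + - Complex pi 0 * conjc w * raisen n f w).
  by apply/funext => w; rewrite !mulNr.
rewrite e1; move: h2; congr is_wirt; ring.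
Qed.

Lemma wirtn_gauss n f : polylim f ->
  wirtn n (fun w => gauss w * f w) = fun w => gauss w * raisen n f w.
Proof.
move=> Ef; rewrite /wirtn; elim: n => [//|n IH].
rewrite iterS IH; apply/funext => z; apply: is_wirtE.
have := is_wirtM (is_wirt_gauss z) (is_wirt_raisen n z Ef).
by congr is_wirt => /=; ring.
Qed.

Lemma raisenD n f g z : polylim f -> polylim g ->
  raisen n (fun w => f w + g w) z = raisen n f z + raisen n g z.
Proof.
elim: n f g => [//|n IH] f g Ef Eg /=.
rewrite wirtD// !IH//; try exact: polylim_wirtP; ring.
Qed.

Lemma raisenZ n c f z : polylim f -> raisen n (fun w => c * f w) z = c * raisen n f z.
Proof.
elim: n f => [//|n IH] f Ef /=; rewrite wirtZ// !IH//; last exact: polylim_wirtP.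
ring.
Qed.

Lemma raisen_sum n (I : Type) (s : seq I) (F : I -> R[i] -> R[i]) z :
  (forall i, polylim (F i)) ->
  raisen n (fun w => \sum_(i <- s) F i w) z = \sum_(i <- s) raisen n (F i) z.
Proof.
move=> EF; elim: s => [|i s IH].
  rewrite big_nil; under [X in raisen _ X]eq_fun do rewrite big_nil -(mul0r 0).
  by rewrite raisenZ ?mul0r//; exact: polylim_cst.
rewrite big_cons -IH -raisenD//; last exact: polylim_sum.
by congr raisen; apply/funext => w; rewrite big_cons.
Qed.

(** Cauchy's estimate on unit discs for the difference, which is written with the scalar -1 so that
    the rules for sums and scalar multiples apply. *)
Lemma wirt_lucvg fs f : (forall k, polylim (fs k)) -> lucvg fs f ->
  lucvg (fun k => wirt (fs k)) (wirt f).
Proof.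
move=> Efs fsf r e e0; have Ef := polylim_lucvg Efs fsf.
have [N hN] := fsf (r + 1) _ e0; exists N => k Nk z zr.
have Em : polylim (fun w => -1 * f w) by exact: polylimZ.
have -> : wirt (fs k) z - wirt f z = wirt (fun w => fs k w + -1 * f w) z.
  by rewrite wirtD// wirtZ// mulN1r.
have [_ _ hb] := polylim_wirt (polylimD (Efs k) Em).
rewrite -[e]divr1; apply: hb => // w wz; rewrite mulN1r; apply: hN => //.
by apply: (le_trans (nrm_leB _ z)); rewrite lerD.
Qed.

Lemma raisen_lucvg n fs f z : (forall k, polylim (fs k)) -> lucvg fs f ->
  ccvg (fun k => raisen n (fs k) z) (raisen n f z).
Proof.
elim: n fs f => [|n IH] fs f Efs fsf /=; first exact: lucvg_ccvg.
have h1 := IH _ _ (fun k => polylim_wirtP (Efs k)) (wirt_lucvg Efs fsf).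
have h2 := IH _ _ Efs fsf.
move=> e e0; set c := Complex pi 0 * conjc z.
have c0 : 0 < nrm c + 1 by rewrite ltr_wpDl ?nrm_ge0.
have [|N1 hN1] := h1 (e / 2); first by lra.
have [|N2 hN2] := h2 (e / 2 / (nrm c + 1)); first by rewrite !divr_gt0.
exists (maxn N1 N2) => k; rewrite geq_max => /andP[k1 k2].
set A := raisen n (wirt (fs k)) z; set B := raisen n (fs k) z.
set A' := raisen n (wirt f) z; set B' := raisen n f z.
have -> : A - c * B - (A' - c * B') = (A - A') - c * (B - B') by ring.
apply: (le_lt_trans (nrmB _ _)); rewrite nrmM.
have := hN1 _ k1; have := hN2 _ k2; rewrite -/A -/B -/A' -/B' ltr_pdivlMr//.
have := nrm_ge0 (B - B'); rewrite mulrDr mulr1 mulrC; lra.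
Qed.

(** Differentiating the exponential produces pi conj l, which is exactly the gap between pi conj z
    and pi conj(z - l). The constant [c] is arbitrary because it only rescales. *)
Lemma raisen_shift n g l c z : polylim g ->
  raisen n (fun w => cexp (Complex pi 0 * conjc l * w - c) * g (w - l)) z
  = cexp (Complex pi 0 * conjc l * z - c) * raisen n g (z - l).
Proof.
elim: n g => [//|n IH] g Eg /=.
pose k := Complex pi 0 * conjc l; pose P := k *: 'X - c%:P : {poly R[i]}.
have PE w : P.[w] = k * w - c by rewrite !hornerE.
have ME w : ('X - l%:P : {poly R[i]}).[w] = w - l by rewrite !hornerE.
have Eg' := polylim_wirtP Eg.
have -> : wirt (fun w => cexp (k * w - c) * g (w - l)) =
    fun w => cexp (k * w - c) * (k * g (w - l) + wirt g (w - l)).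
  apply/funext => w; apply: is_wirtE.
  have e1 : P^`().[w] = k by rewrite /P derivB derivZ derivX derivC subr0 hornerZ hornerC mulr1.
  have e2 : ('X - l%:P : {poly R[i]})^`().[w] = 1.
    by rewrite derivB derivX derivC subr0 hornerC.
  have d1 := cder_is_wirt (cder_comp (cder_cexp P.[w]) (cder_horner P w)).
  have [_ gd _] := polylim_wirt Eg.
  have d2 := cder_is_wirt (cder_comp (gd ('X - l%:P).[w]) (cder_horner _ w)).
  have := is_wirtM d1 d2; rewrite e1 e2 ME PE mulr1.
  under [X in is_wirt X]eq_fun do rewrite PE ME.
  by congr is_wirt; ring.
have Ekg := polylimZ k Eg.
rewrite (IH (fun w => k * g w + wirt g w)); last exact: polylimD.
rewrite IH// raisenD// raisenZ//.
have -> : conjc (z - l) = conjc z - conjc l by rewrite rmorphB.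
rewrite /k; ring.
Qed.

(** Each step either differentiates, which removes at most one factor [Q], or multiplies by conj z,
    which removes none; fewer than [m] steps leave a zero. *)
Lemma raisen_root n m Q h u : polylim Q -> polylim h -> Q u = 0 -> (n < m)%N ->
  raisen n (fun z => Q z ^+ m * h z) u = 0.
Proof.
move=> EQ Eh Qu; elim: n m h Eh => [|n IH] [|m] h Eh //= nm.
  by rewrite exprS Qu !mul0r.
have EQm k : polylim (fun z => Q z ^+ k) by exact: polylimX.
rewrite (IH m.+1 h)//; last by apply: leq_trans nm; rewrite ltnW.
rewrite mulr0 subr0.
suff -> : wirt (fun z => Q z ^+ m.+1 * h z) =
    fun z => Q z ^+ m * (m.+1%:R * wirt Q z * h z + Q z * wirt h z).
  apply: IH => //; apply: polylimD; apply: polylimM => //; last exact: polylim_wirtP.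
  by apply: polylimZ; exact: polylim_wirtP.
rewrite wirtM//; apply/funext => z.
have -> : wirt (fun z0 => Q z0 ^+ m.+1) = fun z => m.+1%:R * Q z ^+ m * wirt Q z.
  elim: (m) => [|k IHk].
    by apply/funext => w; rewrite expr0 !mul1r; congr (wirt _ w).
  under [X in wirt X]eq_fun do rewrite exprS.
  rewrite wirtM// IHk; apply/funext => w; rewrite exprS -[k.+2%:R]natr1; ring.
by rewrite exprS; ring.
Qed.

(** At the origin the conj z terms drop out, so only the n-th derivative of z^n h(z) remains. *)
Lemma raisen_monomial n h : polylim h ->
  raisen n (fun z => z ^+ n * h z) 0 = n`!%:R * h 0.
Proof.
elim: n h => [|n IH] h Eh /=; first by rewrite expr0.
have Eh' := polylim_wirtP Eh.
have J0 : conjc (0 : R[i]) = 0 by rewrite rmorph0.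
rewrite J0 mulr0 mul0r subr0.
have EX : polylim (fun z : R[i] => z ^+ n.+1) by apply: polylimX; exact: polylim_id.
have -> : wirt (fun z => z ^+ n.+1 * h z) =
    fun z => z ^+ n * (n.+1%:R * h z + z * wirt h z).
  rewrite wirtM//; apply/funext => z.
  have -> : wirt (fun z : R[i] => z ^+ n.+1) z = n.+1%:R * z ^+ n.
    have <- : horner ('X^(n.+1) : {poly R[i]}) = fun z => z ^+ n.+1.
      by apply/funext => w; rewrite hornerXn.
    rewrite (cder_wirt (cder_horner _ z)) derivXn hornerMn hornerXn /=.
    by rewrite mulr_natl.
  by rewrite exprS; ring.
rewrite IH; first by rewrite mul0r addr0 factS natrM; ring.
by apply: polylimD; [exact: polylimZ|apply: polylimM => //; exact: polylim_id].
Qed.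

(** * Gaussian growth and its behaviour under the raising operator *)

Definition growth al f := exists C, 0 <= C /\
  forall z, nrm (f z) <= C * expR (al * nrm z ^+ 2).

Lemma growth_wirt al be f : 0 <= al -> al < be -> polylim f -> growth al f ->
  growth be (wirt f).
Proof.
(* On the unit disc about [z] the exponent is at most al (|z| + 1)^2; its cross term 2 al |z| is
   absorbed by (be - al) |z|^2 + al^2 / (be - al). *)
move=> al0 ab Ef [C [C0 fC]]; pose k := al + al ^+ 2 / (be - al).
have d0 : 0 < be - al by lra.
exists (C * expR k); split=> [|z]; first by rewrite mulr_ge0 ?expR_ge0.
have [_ _ hb] := polylim_wirt Ef.
rewrite -mulrA -expRD -[leRHS]divr1; apply: hb => // w wz.
apply: (le_trans (fC w)); rewrite ler_wpM2l// ler_expR.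
have wz1 : nrm w <= nrm z + 1 by apply: (le_trans (nrm_leB _ z)); rewrite lerD.
apply: (@le_trans _ _ (al * (nrm z + 1) ^+ 2)).
  by apply: ler_wpM2l => //; apply: lerXn2r; rewrite ?nnegrE ?addr_ge0 ?nrm_ge0.
have : 0 <= (be - al) * (nrm z - al / (be - al)) ^+ 2.
  by rewrite mulr_ge0 ?sqr_ge0// ltW.
have -> : (be - al) * (nrm z - al / (be - al)) ^+ 2 =
  (be - al) * nrm z ^+ 2 - 2 * al * nrm z + al ^+ 2 / (be - al).
  by field; rewrite gt_eqF.
rewrite /k; lra.
Qed.

Lemma mul_expR_le al be : al < be -> exists2 C, 0 <= C & forall r : R, 0 <= r ->
  r * expR (al * r ^+ 2) <= C * expR (be * r ^+ 2).
Proof.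
move=> ab; have d0 : 0 < be - al by lra.
exists (expR (1 / (4 * (be - al)))) => [|r r0]; first exact: expR_ge0.
rewrite -expRD; apply: (@le_trans _ _ (expR r * expR (al * r ^+ 2))).
  rewrite ler_wpM2r ?expR_ge0//; apply: le_trans (expR_ge1Dx r); lra.
rewrite -expRD ler_expR.
have : 0 <= (be - al) * (r - 1 / (2 * (be - al))) ^+ 2.
  by rewrite mulr_ge0 ?sqr_ge0// ltW.
have -> : (be - al) * (r - 1 / (2 * (be - al))) ^+ 2 =
  (be - al) * r ^+ 2 - r + 1 / (4 * (be - al)).
  by field; rewrite gt_eqF.
lra.
Qed.

Lemma growth_raisen n al be f : 0 <= al -> al < be -> polylim f -> growth al f ->
  growth be (raisen n f).
Proof.
elim: n al be f => [|n IH] al be f al0 ab Ef fa.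
  have [C [C0 fC]] := fa; exists C; split=> // z; apply: (le_trans (fC z)).
  by rewrite ler_wpM2l// ler_expR ler_wpM2r ?exprn_ge0 ?nrm_ge0// ltW.
(* The available slack is halved. For the derivative term, Cauchy's estimate uses the first half and
   the induction the second; for the conj z term, the induction uses the first half and absorbing
   |z| the second. *)
pose ga := (al + be) / 2.
have ag : al < ga by rewrite /ga; lra.
have gb : ga < be by rewrite /ga; lra.
have ga0 : 0 <= ga by lra.
have [C [C0 h1]] := IH _ _ _ ga0 gb (polylim_wirtP Ef) (growth_wirt al0 ag Ef fa).
have [C' [C'0 h2]] := IH _ _ _ al0 ag Ef fa.
have [K K0 hK] := mul_expR_le gb.
have pi0 : 0 <= pi :> R by exact: pi_ge0.
exists (C + pi * C' * K); split=> [|z].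
  by rewrite addr_ge0// mulr_ge0// mulr_ge0.
rewrite /= mulrDl; apply: (le_trans (nrmB _ _)); apply: lerD => //.
rewrite !nrmM nrm_real nrm_conj (ger0_norm pi0).
apply: (@le_trans _ _ (pi * nrm z * (C' * expR (ga * nrm z ^+ 2)))).
  by rewrite ler_wpM2l// mulr_ge0 ?nrm_ge0.
have -> : pi * nrm z * (C' * expR (ga * nrm z ^+ 2)) =
  pi * C' * (nrm z * expR (ga * nrm z ^+ 2)) by ring.
by rewrite -[leRHS]mulrA ler_wpM2l ?mulr_ge0// hK// nrm_ge0.
Qed.

End Raising.

(** * Measurability and Gaussian integrals *)

Section Measurability.
Variable R : realType.
Implicit Types (f g : R[i] -> R[i]) (F : R * R -> R[i]).

Definition cmeasurable F :=
  measurable_fun [set: R * R] (fun p => complex.Re (F p)) /\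
  measurable_fun [set: R * R] (fun p => complex.Im (F p)).

Lemma cmeasurable_cst (c : R[i]) : cmeasurable (fun=> c).
Proof. by split; exact: measurable_cst. Qed.

Lemma cmeasurable_id : cmeasurable (fun p => Complex p.1 p.2).
Proof. by split; [exact: measurable_fst|exact: measurable_snd]. Qed.

Lemma cmeasurable_conj : cmeasurable (fun p => conjc (Complex p.1 p.2)).
Proof.
split; first exact: measurable_fst.
exact: (measurable_funN measurable_snd).
Qed.

Lemma cmeasurableD F G : cmeasurable F -> cmeasurable G ->
  cmeasurable (fun p => F p + G p).
Proof.
move=> [F1 F2] [G1 G2]; split.
- by under eq_fun do rewrite ReD; exact: measurable_funD.
- by under eq_fun do rewrite ImD; exact: measurable_funD.
Qed.

Lemma cmeasurableM F G : cmeasurable F -> cmeasurable G ->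
  cmeasurable (fun p => F p * G p).
Proof.
move=> [F1 F2] [G1 G2]; split.
- by under eq_fun do rewrite ReM; apply: measurable_funB; exact: measurable_funM.
- by under eq_fun do rewrite ImM; apply: measurable_funD; exact: measurable_funM.
Qed.

Lemma cmeasurable_horner (q : {poly R[i]}) :
  cmeasurable (fun p => q.[Complex p.1 p.2]).
Proof.
elim/poly_ind: q => [|q c IH].
  by under eq_fun do rewrite horner0; exact: cmeasurable_cst.
under eq_fun do rewrite hornerMXaddC.
apply: cmeasurableD (cmeasurable_cst c); apply: cmeasurableM IH cmeasurable_id.
Qed.

Lemma cmeasurable_polylim f : polylim f -> cmeasurable (fun p => f (Complex p.1 p.2)).
Proof.
move=> /polylim_seq[p_ /polylim_seq_lucvg pf].
have fz z := lucvg_pt z pf.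
split.
- apply: (measurable_fun_cvg (h := fun k p => complex.Re (p_ k).[Complex p.1 p.2])).
    by move=> k; exact: (cmeasurable_horner (p_ k)).1.
  move=> p _; apply/cvgrPdist_le => e e0.
  have [N hN] := fz (Complex p.1 p.2) _ e0; exists N => //= k Nk.
  rewrite distrC -ReN -ReD; apply: (le_trans (nrm_Re _)); exact: hN.
- apply: (measurable_fun_cvg (h := fun k p => complex.Im (p_ k).[Complex p.1 p.2])).
    by move=> k; exact: (cmeasurable_horner (p_ k)).2.
  move=> p _; apply/cvgrPdist_le => e e0.
  have [N hN] := fz (Complex p.1 p.2) _ e0; exists N => //= k Nk.
  rewrite distrC -ImN -ImD; apply: (le_trans (nrm_Im _)); exact: hN.
Qed.

Lemma cmeasurable_raisen n f : polylim f ->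
  cmeasurable (fun p => raisen n f (Complex p.1 p.2)).
Proof.
elim: n f => [|n IH] f Ef /=; first exact: cmeasurable_polylim.
under eq_fun do rewrite -mulNr.
apply: cmeasurableD; first exact/IH/polylim_wirtP.
apply: cmeasurableM (IH _ Ef).
under eq_fun do rewrite -mulNr.
exact: cmeasurableM (cmeasurable_cst _) cmeasurable_conj.
Qed.

Lemma measurable_gauss (d a b : R) :
  measurable_fun [set: R * R] (fun p => expR (- d * ((p.1 - a) ^+ 2 + (p.2 - b) ^+ 2))).
Proof.
apply: measurableT_comp; first exact: measurable_expR.
apply: measurable_funM; first exact: measurable_cst.
apply: measurable_funD; apply: measurable_funX; apply: measurable_funB;
  by [exact: measurable_fst|exact: measurable_snd|exact: measurable_cst].
Qed.

Lemma measurable_fock_density F : cmeasurable F ->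
  measurable_fun [set: R * R]
    (fun p => nrm (F p) ^+ 2 * expR (- pi * (p.1 ^+ 2 + p.2 ^+ 2))).
Proof.
move=> [F1 F2]; apply: measurable_funM.
  under eq_fun do rewrite nrm_sqr.
  by apply: measurable_funD; exact: measurable_funX.
have := measurable_gauss pi 0 0.
by under eq_fun do rewrite !subr0.
Qed.

Lemma integral_gauss1 (d a : R) : 0 < d ->
  (\int[@lebesgue_measure R]_x (expR (- d * (x - a) ^+ 2))%:E =
   ((normal_peak (Num.sqrt (1 / (2 * d))))^-1)%:E)%E.
Proof.
(* The standard deviation of the normal density proportional to this Gaussian, so its total mass 1
   gives the integral. *)
move=> d0; set s := Num.sqrt _.
have s0 : 0 < 1 / (2 * d) by rewrite divr_gt0// mulr_gt0.
have sn0 : s != 0 by rewrite gt_eqF// sqrtr_gt0.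
have k0 := normal_peak_gt0 sn0.
have -> : (fun x => (expR (- d * (x - a) ^+ 2))%:E) =
    (fun x => ((normal_peak s)^-1)%:E * (normal_pdf a s x)%:E)%E.
  apply/funext => x; rewrite -EFinM; congr _%:E.
  rewrite normal_pdfE// mulKf ?gt_eqF// /normal_fun; congr expR.
  rewrite sqr_sqrtr ?ltW// -mulr_natl; field; exact: lt0r_neq0.
rewrite ge0_integralZl//.
- by rewrite integral_normal_pdf mule1.
- by apply/measurable_EFinP; exact: measurable_normal_pdf.
- by move=> x _; rewrite lee_fin normal_pdf_ge0.
- by rewrite lee_fin invr_ge0 ltW.
Qed.

Lemma integral_gauss2 (d : R) : 0 < d -> exists I : R, forall a b,
  (\int[@lebC R]_p (expR (- d * ((p.1 - a) ^+ 2 + (p.2 - b) ^+ 2)))%:E = I%:E)%E.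
Proof.
move=> d0; set k := (normal_peak (Num.sqrt (1 / (2 * d))))^-1; exists (k * k) => a b.
rewrite /lebC fubini_tonelli1; last 2 first.
- by apply/measurable_EFinP; exact: measurable_gauss.
- by move=> p; rewrite lee_fin expR_ge0.
rewrite /fubini_F /=.
have m1 c : measurable_fun [set: R] (fun y : R => (expR (- d * (y - c) ^+ 2))%:E).
  apply/measurable_EFinP; apply: measurableT_comp; first exact: measurable_expR.
  apply: measurable_funM; first exact: measurable_cst.
  by apply: measurable_funX; apply: measurable_funB => //; exact: measurable_cst.
have k0 : 0 <= k.
  by rewrite invr_ge0; exact: normal_peak_ge0.
have inner x : (\int[@lebesgue_measure R]_y
    (expR (- d * ((x - a) ^+ 2 + (y - b) ^+ 2)))%:E =
    (k * expR (- d * (x - a) ^+ 2))%:E)%E.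
  under eq_integral do rewrite mulrDr expRD EFinM.
  rewrite ge0_integralZl//; first by rewrite integral_gauss1// -EFinM mulrC.
  exact: m1.
under eq_integral do rewrite inner EFinM.
rewrite ge0_integralZl//; first by rewrite integral_gauss1// -EFinM.
exact: m1.
Qed.

(** By Fatou's lemma the integral of the limit is at most the limit inferior of integrals bounded by
    [K]; pointwise convergence identifies the limit inferior of the integrands with [v]. *)
Lemma integrable_fatou d (T : measurableType d) (mu : {measure set T -> \bar R})
    (u : nat -> T -> R) (v : T -> R) (K : R) :
  (forall N, measurable_fun [set: T] (u N)) -> measurable_fun [set: T] v ->
  (forall N x, 0 <= u N x) ->
  (forall x, (u ^~ x @ \oo --> v x)%classic) ->
  (forall N, (\int[mu]_x (u N x)%:E <= K%:E)%E) ->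
  mu.-integrable [set: T] (fun x => (v x)%:E).
Proof.
move=> mu_ mv u0 uv uK; apply/integrableP; split; first exact/measurable_EFinP.
have v0 x : 0 <= v x.
  have c : cvgn (u ^~ x) by apply/cvg_ex; exists (v x); exact: uv.
  by rewrite -(cvg_lim (@Rhausdorff R) (uv x)); apply: limr_ge => //; exact: nearW.
have uvE x : limn_einf (fun N => (u N x)%:E) = (v x)%:E.
  have uvx : ((fun N => (u N x)%:E) @ \oo --> (v x)%:E)%classic.
    by apply: cvg_EFin; [exact: nearW|exact: uv].
  rewrite is_cvg_limn_einfE; last by apply/cvg_ex; exists (v x)%:E.
  exact: cvg_lim.
apply: (@le_lt_trans _ _ (K%:E)%E); last exact: ltry.
have -> : (\int[mu]_x `|(v x)%:E| =
    \int[mu]_x limn_einf (fun N => (u N x)%:E))%E.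
  by apply: eq_integral => x _; rewrite uvE gee0_abs// lee_fin.
apply: le_trans.
  apply: (@fatou _ _ _ mu setT measurableT (fun N x => (u N x)%:E)).
  - by move=> N; exact/measurable_EFinP.
  - by move=> N x _; rewrite lee_fin.
rewrite limn_einf_lim; apply: lime_le; first exact: is_cvg_einfs.
apply: nearW => N; apply: le_trans (uK N); apply: ereal_inf_lbound.
by exists N => /=.
Qed.

End Measurability.

(** * The interpolating function *)

Lemma cauchy_schwarz_sum (R : realType) (I : Type) (s : seq I) (x f : I -> R) :
  (forall i, 0 <= f i) ->
  (\sum_(i <- s) x i * f i) ^+ 2 <=
  (\sum_(i <- s) f i) * (\sum_(i <- s) x i ^+ 2 * f i).
Proof.
move=> f0; elim: s => [|i s IH]; first by rewrite !big_nil mul0r expr0n.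
rewrite !big_cons.
set T := \sum_(j <- s) x j * f j in IH *; set S := \sum_(j <- s) f j in IH *.
set Q := \sum_(j <- s) x j ^+ 2 * f j in IH *.
(* This is the weighted sum of (x_i - x_j)^2 over the earlier indices j, exactly the new excess in
   the induction before multiplication by f_i. *)
have key : 0 <= S * x i ^+ 2 - 2 * x i * T + Q.
  have -> : S * x i ^+ 2 - 2 * x i * T + Q = \sum_(j <- s) (x i - x j) ^+ 2 * f j.
    rewrite /S /T /Q mulr_suml mulr_sumr -sumrB -big_split /=.
    by apply: eq_bigr => j _; ring.
  by apply: sumr_ge0 => j _; rewrite mulr_ge0 ?sqr_ge0.
have := mulr_ge0 (f0 i) key.
have -> : (x i * f i + T) ^+ 2 = T ^+ 2 + 2 * x i * f i * T + (x i * f i) ^+ 2 by ring.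
have -> : (f i + S) * (x i ^+ 2 * f i + Q) =
  S * Q + f i * (S * x i ^+ 2 - 2 * x i * T + Q) + 2 * x i * f i * T + (x i * f i) ^+ 2.
  by ring.
lra.
Qed.

Lemma ccvg_nrm (R : realType) (u : nat -> R[i]) (l : R[i]) : ccvg u l ->
  ((fun N => nrm (u N)) @ \oo --> nrm l)%classic.
Proof.
move=> ul; apply/cvgrPdist_le => e e0; have [N hN] := ul _ e0.
exists N => //= k Nk; have := hN _ Nk.
have := nrm_leB (u k) l; have := nrm_leB l (u k); rewrite [nrm (l - _)]nrmBC.
by rewrite ler_norml; lra.
Qed.

Section Interpolation.
Variables (R : realType) (n : nat) (w1 w2 : R[i]).
Hypothesis hs : (n.+1)%:R < area w1 w2.
Variables (q : R[i] -> R[i]) (a : R[i]).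
Hypothesis hq : forall z : R[i],
  ccvg (fun N => prodsq_nz N (fun m1 m2 => wfac z (latpt w1 w2 m1 m2))) (q z).
Hypothesis ha : exists K : R, forall z : R[i],
  nrm (z * q z * cexp (a * z ^+ 2))
    <= K * expR (pi / (2%:R * area w1 w2) * nrm z ^+ 2).
Implicit Types (z w u : R[i]) (p : int * int).

Local Notation lat p := (latpt w1 w2 p.1 p.2).
Let s := area w1 w2.
Let s0 : 0 < s. Proof. by apply: le_lt_trans hs; rewrite ler0n. Qed.

(** [Q] is sigma_Lambda(u)/u, and [g] below is sigma_Lambda(u)^(n+1) / (n! u), both written without
    dividing by [u] so that they are entire at sight. *)
Let Q u := q u * cexp (a * u ^+ 2).
Let g u := u ^+ n * Q u ^+ n.+1 / (n`!)%:R.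

Let EQ : polylim Q.
Proof.
apply: polylimM; first exact: (sigma_polylim s0 hq).
have -> : (fun u => cexp (a * u ^+ 2)) = fun u => cexp (a *: 'X^2 : {poly R[i]}).[u].
  by apply/funext => u; rewrite hornerZ hornerXn.
exact/polylim_comp/polylim_cexp.
Qed.

Let Eg : polylim g.
Proof.
apply: polylimM; last exact: polylim_cst.
by apply: polylimM; apply: polylimX => //; exact: polylim_id.
Qed.

Let al := n.+1%:R * (pi / (2%:R * s)).

Let al0 : 0 <= al.
Proof. by rewrite mulr_ge0// divr_ge0 ?pi_ge0// mulr_ge0// ltW. Qed.

Let al_lt : al < pi / 2.
Proof.
have -> : al = pi / 2 * (n.+1%:R / s) by rewrite /al; field; rewrite gt_eqF.
by rewrite gtr_pMr ?divr_gt0 ?pi_gt0// ltr_pdivrMr// mul1r.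
Qed.

(** The bound on sigma_Lambda does not control sigma_Lambda(z)/z near 0, so the closed unit disc is
    handled by local boundedness. Outside it |z|^n <= |z|^(n+1) and n! >= 1 give |g(z)| <= |z
    Q(z)|^(n+1). *)
Let g_growth : growth al g.
Proof.
have [K hK] := ha; have [M [M0 hM]] := polylim_bounded 1 Eg.
have K0 : 0 <= `|K| ^+ n.+1 by rewrite exprn_ge0.
exists (`|K| ^+ n.+1 + M); split=> [|z]; first exact: addr_ge0.
have e0 := expR_ge0 (al * nrm z ^+ 2).
have [z1|z1] := leP (nrm z) 1.
  apply: (le_trans (hM _ z1)); rewrite mulrDl; apply: (@le_trans _ _ (M * expR (al * nrm z ^+ 2))).
    rewrite ler_peMr// -[leLHS](expR0) ler_expR.
    by rewrite mulr_ge0// exprn_ge0// nrm_ge0.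
  by rewrite lerDr mulr_ge0.
apply: (@le_trans _ _ (`|K| ^+ n.+1 * expR (al * nrm z ^+ 2))); last first.
  by rewrite ler_wpM2r// lerDl.
have -> : expR (al * nrm z ^+ 2) = expR (pi / (2 * s) * nrm z ^+ 2) ^+ n.+1.
  by rewrite -expRM_natl /al -mulrA.
rewrite -exprMn; apply: (@le_trans _ _ (nrm (z * Q z) ^+ n.+1)); last first.
  apply: lerXn2r; rewrite ?nnegrE ?nrm_ge0 ?mulr_ge0 ?expR_ge0//.
  rewrite /Q mulrA; apply: (le_trans (hK z)).
  by rewrite ler_wpM2r ?expR_ge0// ler_norm.
rewrite /g; move: (Q z) => t; rewrite !nrmM nrmV nrm_nat !nrmX exprMn.
have nt : 0 <= nrm t ^+ n.+1 by rewrite exprn_ge0// nrm_ge0.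
have nz : 0 <= nrm z ^+ n by rewrite exprn_ge0// nrm_ge0.
apply: (@le_trans _ _ (nrm z ^+ n * nrm t ^+ n.+1)).
  rewrite ler_piMr ?mulr_ge0// invf_le1 ?ltr0n ?fact_gt0//.
  by rewrite ler1n fact_gt0.
by rewrite ler_wpM2r// exprS ler_peMl// ltW.
Qed.

Let SnE u : Sn n q a u = raisen n g u.
Proof.
rewrite /Sn (wirtn_gauss n Eg) mulrA -!cexp_real -cexpD.
have -> : Complex (pi * nrm u ^+ 2) 0 + Complex (- pi * nrm u ^+ 2) 0 = 0 :> R[i].
  by apply: complex_ext => /=; ring.
by rewrite cexp0 mul1r.
Qed.

(** The n! produced by the monomial cancels the one in [g], and [Q 0 = 1]. *)
Let raisen_g0 : raisen n g 0 = 1.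
Proof.
have -> : g = fun z => z ^+ n * (Q z ^+ n.+1 / (n`!)%:R).
  by apply/funext => z; rewrite /g mulrA.
rewrite raisen_monomial; last first.
  by apply: polylimM; [exact: polylimX|exact: polylim_cst].
rewrite /Q (sigma0 hq) expr0n mulr0 cexp0 mulr1 expr1n mul1r divff//.
Qed.

Let raisen_g_latpt p : p != (0, 0) -> raisen n g (lat p) = 0.
Proof.
move=> p0.
have -> : g = fun z => Q z ^+ n.+1 * (z ^+ n / (n`!)%:R).
  by apply/funext => z; rewrite /g; ring.
apply: raisen_root => //.
  by apply: polylimM; [apply: polylimX; exact: polylim_id|exact: polylim_cst].
by rewrite /Q (sigma_latpt s0 hq p0) mul0r.
Qed.

Variable c : int -> int -> R[i].
Hypothesis hc : l2 c.

Let e p w := cexp (Complex pi 0 * conjc (lat p) * w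
   - Complex (pi * nrm (lat p) ^+ 2 / 2%:R) 0).

(** Completing the square: Re(pi conj(lambda) w) - pi |lambda|^2 / 2 = (pi/2) |w|^2 - (pi/2) |w -
    lambda|^2. This is the source of the decay away from each lattice point. *)
Let nrm_e p w :
  nrm (e p w) = expR (pi / 2 * nrm w ^+ 2) * expR (- (pi / 2) * nrm (w - lat p) ^+ 2).
Proof.
rewrite nrm_cexp -expRD; congr expR; rewrite !nrm_sqr.
move: (latpt _ _ _ _) w => [l1 l2] [x y].
by rewrite /conjc !(ReD, ImD, ReN, ImN, ReM, ImM) /=; field.
Qed.

Let h p w := c p.1 p.2 * (e p w * g (w - lat p)).

Let Eeg p : polylim (fun w => e p w * g (w - lat p)).
Proof.
apply: polylimM.
  pose P := (Complex pi 0 * conjc (lat p)) *: 'X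
     - (Complex (pi * nrm (lat p) ^+ 2 / 2%:R) 0)%:P : {poly R[i]}.
  have -> : e p = fun w => cexp P.[w].
    by apply/funext => w; rewrite /P hornerD hornerN hornerZ hornerX hornerC.
  exact/polylim_comp/polylim_cexp.
have -> : (fun w => g (w - lat p)) = fun w => g ('X - (lat p)%:P).[w].
  by apply/funext => w; rewrite hornerXsubC.
exact: polylim_comp.
Qed.

Let Eh p : polylim (h p). Proof. exact: polylimZ. Qed.

Let raisen_h p z : raisen n (h p) z = c p.1 p.2 * (e p z * raisen n g (z - lat p)).
Proof. by rewrite /h raisenZ// /e raisen_shift. Qed.

Let HN N w := \sum_(p <- box N) h p w.

Let EHN N : polylim (HN N). Proof. exact: polylim_sum. Qed.

Let raisen_HN N z : raisen n (HN N) z =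
  \sum_(p <- box N) c p.1 p.2 * (e p z * raisen n g (z - lat p)).
Proof. by rewrite /HN raisen_sum//; apply: eq_bigr => p _; exact: raisen_h. Qed.

Let sum_sqr_c : exists2 M, 0 <= M &
  forall N, \sum_(p <- box N) nrm (c p.1 p.2) ^+ 2 <= M.
Proof.
have [M hM] := hc.
have hM' N : \sum_(p <- box N) nrm (c p.1 p.2) ^+ 2 <= M.
  by rewrite -(sum_box_real N (fun a b => nrm (c a b) ^+ 2)).
exists M => //; apply: le_trans (hM' 0%N).
by apply: sumr_ge0 => p _; rewrite exprn_ge0// nrm_ge0.
Qed.

Let c_bounded : exists2 M, 0 <= M & forall p, nrm (c p.1 p.2) <= M.
Proof.
have [M M0 hM] := sum_sqr_c; exists (M + 1) => [|p]; first by lra.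
have : nrm (c p.1 p.2) ^+ 2 <= M.
  apply: le_trans (hM (maxn `|p.1|%N `|p.2|%N)).
  rewrite (big_rem p) /=; last first.
    by rewrite mem_box !mem_zrange; case: (p) => x y /=; lia.
  by rewrite lerDl; apply: sumr_ge0 => p' _; rewrite exprn_ge0// nrm_ge0.
have := sqr_ge0 (nrm (c p.1 p.2) - 1); rewrite sqrrB1; have := nrm_ge0 (c p.1 p.2).
rewrite mulr2n; lra.
Qed.

Let H_ex : exists H, lucvg HN H.
Proof.
apply: box_series_lucvg => r.
have [M M0 hM] := c_bounded; have [C [C0 hC]] := g_growth.
(* [de] is the decay rate in |z - lambda|^2 left after the growth of [g]; half of it becomes decay
   in |lambda|^2, uniform on the disc of radius [r]. *)
pose de := pi / 2 - al; have de0 : 0 < de by rewrite subr_gt0.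
pose k := M * (expR ((pi / 2 + de) * r ^+ 2) * C).
have k0 : 0 <= k by rewrite mulr_ge0// mulr_ge0 ?expR_ge0.
exists (fun p => k * expR (- (de / 2) * nrm (0 - lat p) ^+ 2)).
  apply: bsummableZ => //; split=> [p|]; first exact: expR_ge0.
  have [|B hB] := @latpt_gauss_sum R w1 w2 s0 (de / 2); first by lra.
  by exists B => N; exact: hB.
move=> p z zr; rewrite /h; move: (hC (z - lat p)); move: (g (z - lat p)) => t tC.
rewrite !nrmM nrm_e /k -[leRHS]mulrA.
apply: ler_pM; rewrite ?nrm_ge0 ?mulr_ge0 ?expR_ge0 ?nrm_ge0//.
have r0 : 0 <= r by apply: le_trans zr; exact: nrm_ge0.
have zr2 : nrm z ^+ 2 <= r ^+ 2 by apply: lerXn2r; rewrite ?nnegrE ?nrm_ge0.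
apply: (@le_trans _ _ (expR (pi / 2 * nrm z ^+ 2) * (expR (- (pi / 2) * nrm (z - lat p) ^+ 2)
   * (C * expR (al * nrm (z - lat p) ^+ 2))))).
  by rewrite -[leLHS]mulrA ler_wpM2l ?expR_ge0// ler_wpM2l ?expR_ge0.
rewrite -[leRHS]mulrA [expR (- (pi / 2) * _) * _]mulrCA -expRD mulrCA -expRD.
rewrite [leRHS]mulrCA -expRD ler_wpM2l// ler_expR sub0r nrmN.
have par : nrm (lat p) ^+ 2 <= 2 * nrm (z - lat p) ^+ 2 + 2 * nrm z ^+ 2.
  have h1 := nrm_triB z 0 (lat p); rewrite !sub0r !nrmN in h1.
  have : nrm (lat p) ^+ 2 <= (nrm z + nrm (z - lat p)) ^+ 2.
    by apply: lerXn2r; rewrite ?nnegrE ?addr_ge0 ?nrm_ge0.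
  have := sqr_ge0 (nrm z - nrm (z - lat p)); lra.
have h2 : pi / 2 * nrm z ^+ 2 <= pi / 2 * r ^+ 2.
  by rewrite ler_wpM2l// divr_ge0// pi_ge0.
have h3 : de / 2 * nrm (lat p) ^+ 2 <= de / 2 * (2 * nrm (z - lat p) ^+ 2 + 2 * r ^+ 2).
  by rewrite ler_wpM2l//; lra.
by rewrite /de in h3 *; lra.
Qed.

Section Limit.
Variable H : R[i] -> R[i].
Hypothesis HNH : lucvg HN H.

Let EH : polylim H. Proof. exact: polylim_lucvg HNH. Qed.

Let F := raisen n H.

Lemma interp_cvg z : ccvg (fun N => raisen n (HN N) z) (F z).
Proof. exact: raisen_lucvg. Qed.

Lemma interp_series z : ccvg (fun N => sumsq N (fun m1 m2 =>
     c m1 m2 * cexp (Complex pi 0 * conjc (latpt w1 w2 m1 m2) * z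
                     - Complex (pi * nrm (latpt w1 w2 m1 m2) ^+ 2 / 2%:R) 0)
     * Sn n q a (z - latpt w1 w2 m1 m2))) (F z).
Proof.
have := interp_cvg z; congr (ccvg _ _); apply/funext => N.
rewrite raisen_HN sumsqE; apply: eq_bigr => p _.
by rewrite SnE mulrA.
Qed.

Lemma interp_value m1 m2 : F (latpt w1 w2 m1 m2)
  * Complex (expR (- pi * nrm (latpt w1 w2 m1 m2) ^+ 2 / 2%:R)) 0 = c m1 m2.
Proof.
pose p := (m1, m2); rewrite -/(lat p).
(* Once the box contains [p], the partial sum at this lattice point has a single nonvanishing kernel
   value and is constant. *)
have -> : F (lat p) = c m1 m2 * e p (lat p).
  apply: (ccvg_uniq (interp_cvg (lat p))) => eps eps0.
  exists (maxn `|m1|%N `|m2|%N) => k; rewrite geq_max => /andP[k1 k2].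
  have pk : p \in box k by rewrite mem_box !mem_zrange /=; lia.
  rewrite raisen_HN (bigD1_seq p) ?box_uniq//=.
  rewrite subrr raisen_g0 mulr1 big1 ?addr0 ?subrr ?nrm0// => p' pp'.
  have p0 : (m1 - p'.1, m2 - p'.2) != (0, 0).
    apply: contraNneq pp'; case: p' => x y [] /eqP + /eqP.
    by rewrite !subr_eq0 /p => /eqP -> /eqP ->.
  by rewrite (latptB w1 w2 p p') (raisen_g_latpt p0) !mulr0.
rewrite -mulrA -cexp_real -cexpD.
set X := _ + _; have -> : X = 0; last by rewrite cexp0 mulr1.
rewrite /X; apply: complex_ext; rewrite nrm_sqr;
  move: (latpt _ _ _ _) => [x y];
  by rewrite /conjc !(ReD, ImD, ReN, ImN, ReM, ImM) /=; field.
Qed.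

(** A bound with constants independent of [N] and [z]. Cauchy-Schwarz with the Gaussian weights
    [f p] costs one lattice sum, at most [B] for every [z], and leaves the squared coefficients
    against Gaussians. *)
Let fock_bound : exists2 K, 0 <= K & exists2 de, 0 < de & forall N z,
  nrm (raisen n (HN N) z) ^+ 2 * expR (- pi * nrm z ^+ 2) <=
  \sum_(p <- box N) K * nrm (c p.1 p.2) ^+ 2 * expR (- de * nrm (z - lat p) ^+ 2).
Proof.
(* Half of the gap between [al] and pi/2 pays for the raising operator, the other half remains as
   the decay rate [de]. *)
pose be := (al + pi / 2) / 2.
have ab : al < be by rewrite /be; have := al_lt; lra.
have bp : be < pi / 2 by rewrite /be; have := al_lt; lra.
have [C [C0 hC]] := growth_raisen n al0 ab Eg g_growth.
pose de := pi / 2 - be; have de0 : 0 < de by rewrite subr_gt0.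
have [B hB] := @latpt_gauss_sum R w1 w2 s0 de de0.
have B0 : 0 <= B.
  by apply: le_trans (hB 0 0%N); apply: sumr_ge0 => p _; exact: expR_ge0.
exists (C ^+ 2 * B); first by rewrite mulr_ge0// exprn_ge0.
exists de => // N z.
pose f p := expR (- de * nrm (z - lat p) ^+ 2).
have le1 : nrm (raisen n (HN N) z) * expR (- (pi / 2) * nrm z ^+ 2) <=
    C * \sum_(p <- box N) nrm (c p.1 p.2) * f p.
  rewrite raisen_HN.
  apply: (le_trans (ler_wpM2r (expR_ge0 _) (nrm_sum _ _ _))).
  rewrite mulr_suml mulr_sumr; apply: ler_sum => p _.
  rewrite !nrmM nrm_e.
  have -> : nrm (c p.1 p.2) * (expR (pi / 2 * nrm z ^+ 2)
      * expR (- (pi / 2) * nrm (z - lat p) ^+ 2) * nrm (raisen n g (z - lat p)))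
      * expR (- (pi / 2) * nrm z ^+ 2) =
     nrm (c p.1 p.2) * (expR (- (pi / 2) * nrm (z - lat p) ^+ 2)
       * nrm (raisen n g (z - lat p)))
     * (expR (pi / 2 * nrm z ^+ 2) * expR (- (pi / 2) * nrm z ^+ 2)) by ring.
  have -> : expR (pi / 2 * nrm z ^+ 2) * expR (- (pi / 2) * nrm z ^+ 2) = 1.
    by rewrite -expRD mulNr subrr expR0.
  rewrite mulr1 [leRHS]mulrCA ler_wpM2l ?nrm_ge0//.
  apply: (le_trans (ler_wpM2l (expR_ge0 _) (hC _))).
  rewrite mulrCA -expRD ler_wpM2l// ler_expR /de mulNr; lra.
have -> : expR (- pi * nrm z ^+ 2) = expR (- (pi / 2) * nrm z ^+ 2) ^+ 2.
  by rewrite -expRM_natl; congr expR; field.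
rewrite -exprMn.
apply: (@le_trans _ _ ((C * \sum_(p <- box N) nrm (c p.1 p.2) * f p) ^+ 2)).
  apply: lerXn2r => //; rewrite nnegrE ?mulr_ge0 ?nrm_ge0 ?expR_ge0//.
  by apply: sumr_ge0 => p _; rewrite mulr_ge0 ?nrm_ge0 ?expR_ge0.
rewrite exprMn; have CS := cauchy_schwarz_sum (box N) (fun p => nrm (c p.1 p.2))
  (fun p => expR_ge0 _ : 0 <= f p).
have -> : \sum_(p <- box N) C ^+ 2 * B * nrm (c p.1 p.2) ^+ 2
    * expR (- de * nrm (z - lat p) ^+ 2) =
    C ^+ 2 * (B * \sum_(p <- box N) nrm (c p.1 p.2) ^+ 2 * f p).
  by rewrite !mulr_sumr; apply: eq_bigr => p _; rewrite /f; ring.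
rewrite ler_wpM2l ?exprn_ge0//; apply: (le_trans CS).
rewrite ler_wpM2r//; last exact: hB.
by apply: sumr_ge0 => p _; rewrite mulr_ge0 ?expR_ge0// exprn_ge0// nrm_ge0.
Qed.

Lemma interp_inFock : inFock n F.
Proof.
split; last first.
  set k := Num.sqrt _.
  have k0 : k != 0.
    by rewrite gt_eqF// sqrtr_gt0 divr_gt0 ?exprn_gt0 ?pi_gt0// ltr0n fact_gt0.
  (* Dividing by [k] cancels the normalising constant in the definition of the space. *)
  pose H' := fun w => Complex k^-1 0 * H w.
  have EH' : polylim H' by exact: polylimZ.
  exists H'; split; first exact: polylim_entire.
  move=> z; rewrite (wirtn_gauss n EH') raisenZ// -/F.
  rewrite -!cexp_real; set x := cexp _; set y := cexp _.
  have xy : x * y = 1.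
    rewrite /x /y -cexpD -cexp0; congr cexp; apply: complex_ext => /=; ring.
  have kk : Complex k 0 * Complex k^-1 0 = 1 :> R[i].
    by apply: complex_ext => /=; field.
  rewrite (_ : _ * _ = Complex k 0 * Complex k^-1 0 * (x * y) * F z); last by ring.
  by rewrite xy kk !mul1r.
have [K K0 [de de0 hK]] := fock_bound.
have [M M0 hM] := sum_sqr_c.
have [I hI] := integral_gauss2 de0.
have I0 : 0 <= I.
  by rewrite -lee_fin -(hI 0 0); apply: integral_ge0 => p _; rewrite lee_fin expR_ge0.
have E2 (p : R * R) : p.1 ^+ 2 + p.2 ^+ 2 = nrm (Complex p.1 p.2) ^+ 2.
  by rewrite nrm_sqr.
(* Each Gaussian integrates to the same [I], and the squared coefficients sum to at most [M], so K M
   I bounds the integrals of all partial sums. *)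
apply: (@integrable_fatou R _ _ ((@lebesgue_measure R) \x (@lebesgue_measure R))%E
  (fun N (p : R * R) => nrm (raisen n (HN N) (Complex p.1 p.2)) ^+ 2
     * expR (- pi * (p.1 ^+ 2 + p.2 ^+ 2)))
  (fun p : R * R => nrm (F (Complex p.1 p.2)) ^+ 2
     * expR (- pi * (p.1 ^+ 2 + p.2 ^+ 2))) (K * M * I)).
- by move=> N; apply: measurable_fock_density; exact: cmeasurable_raisen.
- by apply: measurable_fock_density; exact: cmeasurable_raisen.
- by move=> N p; rewrite mulr_ge0 ?expR_ge0// exprn_ge0// nrm_ge0.
- move=> p; have := ccvg_nrm (interp_cvg (Complex p.1 p.2)) => cv.
  under eq_fun do rewrite expr2.
  by rewrite expr2; apply: cvgM; [exact: cvgM|exact: cvg_cst].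
move=> N.
pose G (p : int * int) (x : R * R) : \bar R := ((K * nrm (c p.1 p.2) ^+ 2)%:E *
  (expR (- de * ((x.1 - complex.Re (lat p)) ^+ 2 + (x.2 - complex.Im (lat p)) ^+ 2)))%:E)%E.
have mG0 p : measurable_fun [set: R * R] (fun x : R * R =>
    (expR (- de * ((x.1 - complex.Re (lat p)) ^+ 2 + (x.2 - complex.Im (lat p)) ^+ 2)))%:E).
  by apply/measurable_EFinP; exact: measurable_gauss.
have k0 p : 0 <= K * nrm (c p.1 p.2) ^+ 2 by rewrite mulr_ge0// exprn_ge0// nrm_ge0.
have G0 p x : (0 <= G p x)%E by rewrite mule_ge0// lee_fin// expR_ge0.
have mG p : measurable_fun [set: R * R] (G p) by exact: measurable_funeM.
apply: (@le_trans _ _ (\int[@lebC R]_x (\sum_(p <- box N) G p x))%E).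
  apply: ge0_le_integral => //.
  - by move=> x _; rewrite lee_fin mulr_ge0 ?expR_ge0// exprn_ge0// nrm_ge0.
  - apply/measurable_EFinP; apply: measurable_fock_density; exact: cmeasurable_raisen.
  - by apply: emeasurable_sum => p _; exact: mG.
  move=> x _; rewrite E2 /G.
  under eq_bigr do rewrite -EFinM.
  rewrite sumEFin lee_fin; apply: (le_trans (hK _ _)).
  apply: ler_sum => p _; rewrite ler_wpM2l// ler_expR ler_wnM2l ?oppr_le0 ?(ltW de0)//.
  by rewrite nrm_sqr !(ReD, ImD, ReN, ImN).
rewrite ge0_integral_sum//.
have -> : (\sum_(p <- box N) \int[@lebC R]_x G p x =
   \sum_(p <- box N) (K * nrm (c p.1 p.2) ^+ 2 * I)%:E)%E.
  apply: eq_bigr => p _; rewrite /G ge0_integralZl//.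
  - by rewrite hI -EFinM.
  - exact: mG0.
  - by rewrite lee_fin.
rewrite sumEFin lee_fin -mulr_suml -mulr_sumr.
by rewrite ler_wpM2r// ler_wpM2l.
Qed.

End Limit.

Lemma interp_exists : exists F : R[i] -> R[i],
    (forall z : R[i],
       ccvg (fun N => sumsq N (fun m1 m2 =>
               c m1 m2
               * cexp (Complex pi 0 * conjc (latpt w1 w2 m1 m2) * z
                       - Complex (pi * nrm (latpt w1 w2 m1 m2) ^+ 2 / 2%:R) 0)
               * Sn n q a (z - latpt w1 w2 m1 m2)))
            (F z))
    /\ inFock n F
    /\ (forall m1 m2 : int,
          F (latpt w1 w2 m1 m2)
            * Complex (expR (- pi * nrm (latpt w1 w2 m1 m2) ^+ 2 / 2%:R)) 0
          = c m1 m2).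
Proof.
have [H HH] := H_ex; exists (raisen n H); split; first exact: interp_series.
split; [exact: interp_inFock|exact: interp_value].
Qed.

End Interpolation.

Unset Implicit Arguments.

Theorem theorem1 (R : realType) (n : nat) (w1 w2 : R[i])
  (indep : forall r1 r2 : R,
     Complex r1 0 * w1 + Complex r2 0 * w2 = 0 -> r1 = 0 /\ r2 = 0)
  (hs : (n.+1)%:R < area w1 w2)
  (* q = sigma(z)/z = the Weierstrass product over Lambda \ {0} *)
  (q : R[i] -> R[i])
  (hq : forall z : R[i],
     ccvg (fun N => prodsq_nz N (fun m1 m2 => wfac z (latpt w1 w2 m1 m2))) (q z))
  (* a = a(Lambda): sigma_Lambda(z) = sigma(z) e^{a z^2} = z q(z) e^{a z^2} *)
  (a : R[i])
  (ha : exists K : R, forall z : R[i],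
     Normc.normc (z * q z * cexp (a * z ^+ 2))
       <= K * expR (pi / (2%:R * area w1 w2) * Normc.normc z ^+ 2))
  (c : int -> int -> R[i]) (hc : l2 c) :
  exists F : R[i] -> R[i],
    (forall z : R[i],
       ccvg (fun N => sumsq N (fun m1 m2 =>
               c m1 m2
               * cexp (Complex pi 0 * conjc (latpt w1 w2 m1 m2) * z
                       - Complex (pi * Normc.normc (latpt w1 w2 m1 m2) ^+ 2 / 2%:R) 0)
               * Sn n q a (z - latpt w1 w2 m1 m2)))
            (F z))
    /\ inFock n F
    /\ (forall m1 m2 : int,
          F (latpt w1 w2 m1 m2)
            * Complex (expR (- pi * Normc.normc (latpt w1 w2 m1 m2) ^+ 2 / 2%:R)) 0
          = c m1 m2).
Proof. exact: (interp_exists hs hq ha hc). Qed.
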